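(* Let $\mathcal{A}$ and $\mathcal{B}$ be (infinite dimensional) UHF-algebras so that $\mathcal{B}$ admits a unital embedding into $\mathcal{A}$. Then there exists a $C^*$-irreducible embedding $\iota \colon \mathcal{B} \to \mathcal{A}$.
   Context: A UHF-algebra here is an infinite tensor product $\bigotimes_{n=1}^\infty M_{k_n}(\mathbb{C})$ with integers $k_n\ge 2$. A unital embedding is a unital injective $^*$-homomorphism. A unital embedding $\iota\colon \mathcal{B}\to\mathcal{A}$ is $C^*$-irreducible if the unital inclusion $\iota(\mathcal{B})\subseteq\mathcal{A}$ is $C^*$-irreducible, i.e., each intermediate $C^*$-algebra $\iota(\mathcal{B}) \subseteq \mathcal{D} \subseteq \mathcal{A}$ (including $\iota(\mathcal{B})$ and $\mathcal{A}$) is simple. *)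

(* Defs.v *)
From HB Require Import structures.
From mathcomp Require Import all_boot all_order all_algebra.
From mathcomp Require Import complex mxtens.
From mathcomp Require Import all_classical all_reals all_analysis.

Set Implicit Arguments.
Unset Strict Implicit.
Unset Printing Implicit Defensive.

Import Order.TTheory GRing.Theory Num.Theory.
Import numFieldNormedType.Exports.

Local Open Scope classical_set_scope.
Local Open Scope ring_scope.

(* Unital star-algebras over the complex numbers R[i].  The product is a field
   of the mixin rather than the one of GRing.Algebra because HB cannot join
   the ring hierarchy with normed modules over another ring: their join is
   already taken by Num.NumDomain, whose norm has values in the ring itself. *)
HB.mixin Record isStarAlgebra (R : realType) A of GRing.Lmodule R[i] A := {
  smul : A -> A -> A;
  sone : A;
  adj : A -> A;
  smulA : forall x y z, smul x (smul y z) = smul (smul x y) z;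
  smul1l : forall x, smul sone x = x;
  smul1r : forall x, smul x sone = x;
  smulDl : forall x y z, smul (x + y) z = smul x z + smul y z;
  smulDr : forall x y z, smul x (y + z) = smul x y + smul x z;
  smulZl : forall (a : R[i]) x y, smul (a *: x) y = a *: smul x y;
  smulZr : forall (a : R[i]) x y, smul x (a *: y) = a *: smul x y;
  adjK : forall x, adj (adj x) = x;
  adjD : forall x y, adj (x + y) = adj x + adj y;
  adjZ : forall (a : R[i]) x, adj (a *: x) = Num.conj a *: adj x;
  adjM : forall x y, adj (smul x y) = smul (adj y) (adj x)
}.

#[short(type="starAlgType")]
HB.structure Definition StarAlgebra (R : realType) :=
  { A of GRing.Lmodule R[i] A & isStarAlgebra R A }.

Notation "x ** y" := (smul x y) (at level 40, left associativity) : ring_scope.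

HB.mixin Record StarAlgebra_isCStar (R : realType) A
    of StarAlgebra R A & CompleteNormedModule R[i] A := {
  cstar_normM : forall x y : A, `|x ** y| <= `|x| * `|y|;
  cstar_normE : forall x : A, `|adj x ** x| = `|x| ^+ 2
}.

#[short(type="cstarAlgType")]
HB.structure Definition CStarAlgebra (R : realType) :=
  { A of StarAlgebra R A & CompleteNormedModule R[i] A
       & StarAlgebra_isCStar R A }.

Section MatrixStarAlgebra.
Variables (R : realType) (n : nat).
Implicit Types (A B : 'M[R[i]]_n).

Definition mxadj A : 'M[R[i]]_n := (map_mx Num.conj A)^T.

Fact mxadjK A : mxadj (mxadj A) = A.
Proof. by apply/matrixP => i j; rewrite !mxE conjCK. Qed.

Fact mxadjD A B : mxadj (A + B) = mxadj A + mxadj B.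
Proof. by apply/matrixP => i j; rewrite !mxE rmorphD. Qed.

Fact mxadjZ (a : R[i]) A : mxadj (a *: A) = Num.conj a *: mxadj A.
Proof. by apply/matrixP => i j; rewrite !mxE rmorphM. Qed.

Fact mxadjM A B : mxadj (A *m B) = mxadj B *m mxadj A.
Proof. by rewrite /mxadj map_mxM trmx_mul. Qed.

HB.instance Definition _ := isStarAlgebra.Build R 'M[R[i]]_n
  (@mulmxA _ n n n n) (@mul1mx _ n n) (@mulmx1 _ n n)
  (@mulmxDl _ n n n) (@mulmxDr _ n n n)
  (fun a A B => esym (scalemxAl a A B)) (fun a A B => esym (scalemxAr a A B))
  mxadjK mxadjD mxadjZ mxadjM.

End MatrixStarAlgebra.

Section CStar.
Variable R : realType.

Record unital_embedding (U V : starAlgType R) (f : U -> V) : Prop := {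
  emb_add : forall x y, f (x + y) = f x + f y;
  emb_scale : forall (a : R[i]) x, f (a *: x) = a *: f x;
  emb_mul : forall x y, f (x ** y) = f x ** f y;
  emb_one : f sone = sone;
  emb_adj : forall x, f (adj x) = adj (f x);
  emb_inj : injective f
}.

Record cstar_subalgebra (A : cstarAlgType R) (D : set A) : Prop := {
  csub_closed : closed D;
  csub0 : D 0;
  csubD : forall x y, D x -> D y -> D (x + y);
  csubZ : forall (a : R[i]) x, D x -> D (a *: x);
  csubM : forall x y, D x -> D y -> D (x ** y);
  csub_adj : forall x, D x -> D (adj x)
}.

Record closed_ideal (A : cstarAlgType R) (D J : set A) : Prop := {
  ideal_sub : J `<=` D;
  ideal_closed : closed J;
  ideal0 : J 0;
  idealD : forall x y, J x -> J y -> J (x + y);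
  idealZ : forall (a : R[i]) x, J x -> J (a *: x);
  idealMl : forall d x, D d -> J x -> J (d ** x);
  idealMr : forall d x, D d -> J x -> J (x ** d)
}.

Definition cstar_simple (A : cstarAlgType R) (D : set A) : Prop :=
  forall J : set A, closed_ideal D J -> J = [set 0] \/ J = D.

Definition cstar_irreducible (A : cstarAlgType R) (B : set A) : Prop :=
  forall D : set A, cstar_subalgebra D -> B `<=` D -> cstar_simple D.

Definition cstar_irreducible_embedding (B A : cstarAlgType R) (iota : B -> A) :
  Prop := unital_embedding iota /\ cstar_irreducible (range iota).

Fixpoint tensor_size (k : nat -> nat) (n : nat) : nat :=
  if n is m.+1 then (tensor_size k m * k m)%N else 1%N.

(* A is the C*-completion of the union of the increasing sequence of
   M_{k_0} (x) ... (x) M_{k_(n-1)} = M_{k_0 ... k_(n-1)} under the connecting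
   maps a |-> a (x) 1, with (x) realised as the Kronecker product *t.  The
   norm on the union need not be prescribed: a matrix algebra has only one
   C*-norm, and injective star-homomorphisms are isometric. *)
Definition infinite_tensor_product (k : nat -> nat) (A : cstarAlgType R) :
    Prop :=
  exists phi : forall n, 'M[R[i]]_(tensor_size k n) -> A,
    [/\ forall n, unital_embedding (phi n),
        forall n (a : 'M[R[i]]_(tensor_size k n)),
          phi n.+1 (a *t (1%:M : 'M[R[i]]_(k n))) = phi n a &
        closure (\bigcup_n range (phi n)) = [set: A]].

Definition UHF (A : cstarAlgType R) : Prop :=
  exists k : nat -> nat,
    (forall n, (2 <= k n)%N) /\ infinite_tensor_product k A.

End CStar.

(* Main.v *)
Require Import Defs.
From HB Require Import structures.
From mathcomp Require Import all_boot all_order all_algebra.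
From mathcomp Require Import complex mxtens.
From mathcomp Require Import all_classical all_reals all_analysis.
From mathcomp Require Import ring lra.

Set Implicit Arguments.
Unset Strict Implicit.
Unset Printing Implicit Defensive.

Import Order.TTheory GRing.Theory Num.Theory.
Import numFieldNormedType.Exports.

Local Open Scope classical_set_scope.
Local Open Scope ring_scope.

(* Matrix levels M_(K_n) of A and M_(L_n) of B are chosen so that
   L_n | K_n <= L_(n+1), which is possible because a unital embedding of M_L
   into A forces L to divide some K_n.  An embedding M_(L_n) -> M_(K_n) is given
   by a bijection [K_n] = [L_n] x [d_n] of index sets.  These are chosen
   recursively: the multiplicity d_n k_n = l_n d_(n+1) of M_(L_n) in M_(K_(n+1))
   is grouped into blocks of length d_n on the side of A and into blocks of
   length l_n >= d_n on the side of B.  Averaging a positive element of M_(K_n)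
   over a finite set of unitaries of M_(L_(n+1)) then yields a diagonal matrix
   whose entries are all at least half the normalised trace.  Since the trace of
   the approximants of a nonzero positive element of A stays away from 0, an
   ideal of an intermediate algebra containing such an element has a member at
   distance < 1 from 1, hence contains 1. *)

(** * Norms on C*-algebras and matrices *)

(** An embedding whose image commutes with a nonscalar self-adjoint element is never irreducible:
    together they generate an algebra with nontrivial centre. The natural inclusions a |-> a (x) 1
    of the finite levels do have large commutants, so the commutant of one level has to be absorbed
    into the matrix indices of the next; this is what the regrouping of multiplicities achieves. The
    factor one half arises because a window of length l >= d contains at least l / (2 d) full
    periods of length d. The averaging uses unitaries of the image of [B] only. It therefore
    preserves every ideal of every intermediate algebra, and being contractive it tolerates
    approximants taken from [A], so nothing has to be known about the intermediate algebra itself.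
    No trace on [A] is built: [hs] divided by the matrix size plays that role at each finite level.
    The norm of [A] is abstract, so its restriction to the matrix levels is first identified with
    the operator norm. The given embedding supplies matrix units in [A], and perturbing them into a
    finite level gives the divisibility of sizes. *)

Section RealNorm.
Variable R : realType.
Local Notation C := R[i].
Local Notation "x %:C" := (real_complex R x).

Definition nsq (z : C) : R := complex.Re z ^+ 2 + complex.Im z ^+ 2.

Lemma nsqE z : (nsq z)%:C = z * Num.conj z.
Proof.
rewrite -normCK; case: z => a b.
rewrite -[`|_|]/((Num.sqrt (a ^+ 2 + b ^+ 2))%:C) -rmorphXn /= sqr_sqrtr //.
by rewrite addr_ge0 ?sqr_ge0.
Qed.

Lemma nsq_ge0 z : 0 <= nsq z.
Proof. by rewrite addr_ge0 ?sqr_ge0. Qed.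

Lemma nsqM z t : nsq (z * t) = nsq z * nsq t.
Proof. by apply: (@complexI R); rewrite rmorphM /= !nsqE rmorphM mulrACA. Qed.

Lemma nsq_eq0 z : (nsq z == 0) = (z == 0).
Proof.
case: z => a b; rewrite /nsq /= paddr_eq0 ?sqr_ge0 // !sqrf_eq0.
by rewrite eq_complex.
Qed.

Lemma nsqD z t : nsq (z + t) <= 2 * nsq z + 2 * nsq t.
Proof.
case: z t => a b [c d]; rewrite /nsq /=.
have := sqr_ge0 (a - c); have := sqr_ge0 (b - d); nra.
Qed.

Lemma nsq_conj z : nsq (Num.conj z) = nsq z.
Proof. by apply: (@complexI R); rewrite !nsqE conjCK mulrC. Qed.

Lemma nsqN z : nsq (- z) = nsq z.
Proof. by case: z => a b; rewrite /nsq /= !sqrrN. Qed.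

Lemma nsq_real (x : R) : nsq x%:C = x ^+ 2.
Proof. by rewrite /nsq /= expr0n addr0. Qed.

Lemma nsq0 : nsq 0 = 0.
Proof. by apply/eqP; rewrite nsq_eq0. Qed.

Lemma nsq1 : nsq 1 = 1.
Proof. by rewrite (nsq_real 1) expr1n. Qed.

(** Norms of modules over [R[i]] take values in [R[i]]; the real part moves them to the ordered
    field [R], where [lra] and [nra] apply. *)
Definition nrm (V : normedModType C) (x : V) : R := complex.Re `|x|.

Lemma nrmE (V : normedModType C) (x : V) : `|x| = (nrm x)%:C.
Proof.
rewrite /nrm; have := normr_ge0 x; case: `|x| => a b.
by rewrite lecE /= => /andP[/eqP -> _].
Qed.

Section NrmTheory.
Variable V : normedModType C.
Implicit Types x y : V.

Lemma nrm_ge0 x : 0 <= nrm x.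
Proof. by have := normr_ge0 x; rewrite nrmE ler0c. Qed.

Lemma nrm_eq0 x : (nrm x == 0) = (x == 0).
Proof.
rewrite -(normr_eq0 x) nrmE -(rmorph0 (real_complex R)).
by rewrite (inj_eq (@complexI R)).
Qed.

Lemma nrm0 : nrm (0 : V) = 0.
Proof. by apply/eqP; rewrite nrm_eq0. Qed.

Lemma nrmD x y : nrm (x + y) <= nrm x + nrm y.
Proof. by have := ler_normD x y; rewrite !nrmE -rmorphD lecR. Qed.

Lemma nrmN x : nrm (- x) = nrm x.
Proof. by rewrite /nrm normrN. Qed.

Lemma nrmB x y : nrm (x - y) = nrm (y - x).
Proof. by rewrite -nrmN opprB. Qed.

Lemma nrmZ (a : C) x : nrm (a *: x) = Num.sqrt (nsq a) * nrm x.
Proof.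
apply: (@complexI R); rewrite -nrmE normrZ nrmE rmorphM /=.
by case: a.
Qed.

Lemma nrmZr (a : R) x : 0 <= a -> nrm (a%:C *: x) = a * nrm x.
Proof. by move=> a0; rewrite nrmZ nsq_real sqrtr_sqr ger0_norm. Qed.

Lemma nrm_sum (I : Type) (r : seq I) (P : pred I) (F : I -> V) :
  nrm (\sum_(i <- r | P i) F i) <= \sum_(i <- r | P i) nrm (F i).
Proof.
elim/big_ind2: _ => [|x a y b xa yb|//]; first by rewrite nrm0.
exact: le_trans (nrmD _ _) (lerD xa yb).
Qed.

Lemma nrm_distD x y z : nrm (x - z) <= nrm (x - y) + nrm (y - z).
Proof. by rewrite -(subrKA y x (- z)) nrmD. Qed.

Lemma nrm_le_dist x y : nrm x <= nrm (x - y) + nrm y.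
Proof. by rewrite -{1}(subrK y x) nrmD. Qed.

End NrmTheory.

Section CStarTheory.
Variable A : cstarAlgType R.
Implicit Types x y z : A.

Lemma smulNl x y : (- x) ** y = - (x ** y).
Proof. by rewrite -scaleN1r smulZl scaleN1r. Qed.

Lemma smulNr x y : x ** (- y) = - (x ** y).
Proof. by rewrite -scaleN1r smulZr scaleN1r. Qed.

Lemma smulBl x y z : (x - y) ** z = x ** z - y ** z.
Proof. by rewrite smulDl smulNl. Qed.

Lemma smulBr x y z : z ** (x - y) = z ** x - z ** y.
Proof. by rewrite smulDr smulNr. Qed.

Lemma adjN x : adj (- x) = - adj x.
Proof. by rewrite -scaleN1r Defs.adjZ rmorphN1 scaleN1r. Qed.

Lemma adjB x y : adj (x - y) = adj x - adj y.
Proof. by rewrite adjD adjN. Qed.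

Lemma adj1 : adj (sone : A) = sone.
Proof.
have := adjM (sone : A) (adj sone).
by rewrite smul1l adjK smul1l => /esym.
Qed.

Lemma nrmM x y : nrm (x ** y) <= nrm x * nrm y.
Proof. by have := cstar_normM x y; rewrite !nrmE -rmorphM lecR. Qed.

Lemma nrm_cstar x : nrm (adj x ** x) = nrm x ^+ 2.
Proof. by apply: (@complexI R); rewrite rmorphXn /= -!nrmE cstar_normE. Qed.

Lemma nrm_adj x : nrm (adj x) = nrm x.
Proof.
suff le z : nrm z <= nrm (adj z) by apply/eqP; rewrite eq_le le -{2}(adjK x) le.
have [->|z0] := eqVneq z 0; first by rewrite nrm0 nrm_ge0.
have z_gt0 : 0 < nrm z by rewrite lt_def nrm_eq0 z0 nrm_ge0.
by rewrite -(ler_pM2r z_gt0) -expr2 -nrm_cstar nrmM.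
Qed.

Lemma nrm_cstar_r x : nrm (x ** adj x) = nrm x ^+ 2.
Proof. by rewrite -{1}(adjK x) nrm_cstar nrm_adj. Qed.

Lemma nrm1_le : nrm (sone : A) <= 1.
Proof.
have := nrm_cstar sone; rewrite adj1 smul1l.
have := nrm_ge0 (sone : A); nra.
Qed.

Lemma nrm_isometry x : adj x ** x = sone -> nrm x <= 1.
Proof.
move=> xx; have := nrm_cstar x; rewrite xx; have := nrm1_le.
have := nrm_ge0 x; nra.
Qed.

Lemma nrm_distM x y x' y' :
  nrm (x ** y - x' ** y') <= nrm (x - x') * nrm y + nrm x' * nrm (y - y').
Proof.
have -> : x ** y - x' ** y' = (x - x') ** y + x' ** (y - y').
  by rewrite smulBl smulBr subrKA.
by apply: le_trans (nrmD _ _) (lerD _ _); rewrite nrmM.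
Qed.

End CStarTheory.

(** * Squared Hilbert-Schmidt norms *)

Section HilbertSchmidt.

(** On square matrices this is convertible to [adj]; the rectangular form also covers row vectors,
    for which [w *m mxct v] is the inner product. *)
Definition mxct m n (v : 'M[C]_(m, n)) : 'M[C]_(n, m) := (map_mx Num.conj v)^T.

Lemma mxctM m n p (v : 'M[C]_(m, n)) (w : 'M[C]_(n, p)) :
  mxct (v *m w) = mxct w *m mxct v.
Proof. by rewrite /mxct map_mxM trmx_mul. Qed.

Lemma mxctK m n (v : 'M[C]_(m, n)) : mxct (mxct v) = v.
Proof. by apply/matrixP => i j; rewrite !mxE conjCK. Qed.

(** The square of the Hilbert-Schmidt norm, not normalised; for a row vector it is the squared
    Euclidean length. *)
Definition hs m n (v : 'M[C]_(m, n)) : R := \sum_i \sum_j nsq (v i j).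

Lemma hs_ge0 m n (v : 'M[C]_(m, n)) : 0 <= hs v.
Proof. by rewrite sumr_ge0 // => i _; rewrite sumr_ge0 // => j _;
  exact: nsq_ge0. Qed.

Lemma nsq_le_hs m n (v : 'M[C]_(m, n)) i j : nsq (v i j) <= hs v.
Proof.
rewrite /hs (bigD1 i) //= (bigD1 j) //= -addrA lerDl addr_ge0 //.
  by rewrite sumr_ge0 // => *; exact: nsq_ge0.
by rewrite sumr_ge0 // => *; rewrite sumr_ge0 // => *; exact: nsq_ge0.
Qed.

Lemma hs_eq0 m n (v : 'M[C]_(m, n)) : hs v <= 0 -> v = 0.
Proof.
move=> v0; apply/matrixP => i j; rewrite mxE; apply/eqP.
by rewrite -nsq_eq0 eq_le nsq_ge0 andbT (le_trans (nsq_le_hs _ _ _)).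
Qed.

Lemma hs0 m n : hs (0 : 'M[C]_(m, n)) = 0.
Proof.
rewrite /hs big1 // => i _; rewrite big1 // => j _.
by apply/eqP; rewrite mxE nsq_eq0.
Qed.

Lemma hs_ct m n (v : 'M[C]_(m, n)) : hs (mxct v) = hs v.
Proof.
rewrite /hs exchange_big; apply: eq_bigr => i _; apply: eq_bigr => j _.
by rewrite !mxE nsq_conj.
Qed.

Lemma hsN m n (v : 'M[C]_(m, n)) : hs (- v) = hs v.
Proof.
rewrite /hs; apply: eq_bigr => i _; apply: eq_bigr => j _.
by rewrite !mxE nsqN.
Qed.

Lemma hsD m n (v w : 'M[C]_(m, n)) : hs (v + w) <= 2 * hs v + 2 * hs w.
Proof.
rewrite /hs !mulr_sumr -big_split /= ler_sum // => i _.
by rewrite !mulr_sumr -big_split /= ler_sum // => j _; rewrite mxE nsqD.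
Qed.

Lemma hs_trace m n (v : 'M[C]_(m, n)) : (hs v)%:C = \tr (v *m mxct v).
Proof.
rewrite /hs rmorph_sum; apply: eq_bigr => i _; rewrite rmorph_sum mxE /=.
by apply: eq_bigr => j _; rewrite nsqE !mxE.
Qed.

Lemma hs_rows m n (v : 'M[C]_(m, n)) : hs v = \sum_i hs (row i v).
Proof.
rewrite /hs; apply: eq_bigr => i _; rewrite big_ord1.
by apply: eq_bigr => j _; rewrite mxE.
Qed.

End HilbertSchmidt.

End RealNorm.

(** * C*-norms on matrix algebras *)

Section Embedding.
Variables (R : realType) (U V : starAlgType R) (f : U -> V).
Hypothesis fE : unital_embedding f.

Lemma emb0 : f 0 = 0.
Proof. by rewrite -(scale0r 0) (emb_scale fE) scale0r. Qed.

Lemma embN x : f (- x) = - f x.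
Proof. by rewrite -scaleN1r (emb_scale fE) scaleN1r. Qed.

Lemma embB x y : f (x - y) = f x - f y.
Proof. by rewrite (emb_add fE) embN. Qed.

Lemma emb_sum (I : Type) (r : seq I) (P : pred I) (F : I -> U) :
  f (\sum_(i <- r | P i) F i) = \sum_(i <- r | P i) f (F i).
Proof. exact: (big_morph _ (emb_add fE) emb0). Qed.

End Embedding.

Lemma emb_comp (R : realType) (U V W : starAlgType R) (f : U -> V)
    (g : V -> W) :
  unital_embedding f -> unital_embedding g -> unital_embedding (g \o f).
Proof.
move=> fE gE; split => [x y|a x|x y||x|x y] /=.
- by rewrite (emb_add fE) (emb_add gE).
- by rewrite (emb_scale fE) (emb_scale gE).
- by rewrite (emb_mul fE) (emb_mul gE).
- by rewrite (emb_one fE) (emb_one gE).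
- by rewrite (emb_adj fE) (emb_adj gE).
- by move=> /(emb_inj gE) /(emb_inj fE).
Qed.

(** If r > q > 0, Bernoulli's inequality makes (r / q)^(2^k) unbounded. The exponents are powers of
    two because the C*-identity controls repeated squaring. *)
Lemma le_of_expn_bound (R : archiRealFieldType) (r q c : R) :
  0 <= q -> 0 <= r -> (forall k, r ^+ (2 ^ k) <= c * q ^+ (2 ^ k)) -> r <= q.
Proof.
move=> q0 r0 rq; have [//|qr] := leP r q.
have [qgt0|qle0] := ltP 0 q; last first.
  have q_eq0 : q = 0 by lra.
  by have := rq 0; rewrite expn0 !expr1 q_eq0 mulr0 leNgt -{1}q_eq0 qr.
have {}rq k : (r / q) ^+ (2 ^ k) <= c.
  by rewrite exprMn exprVn ler_pdivrMr ?exprn_gt0.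
have x1 : 0 < r / q - 1 by rewrite subr_gt0 ltr_pdivlMr ?mul1r.
have bernoulli n : 1 + n%:R * (r / q - 1) <= (r / q) ^+ n.
  elim: n => [|n IH]; first by rewrite mul0r addr0 expr0.
  rewrite exprS -natr1; have : 0 <= n%:R :> R by [].
  move: (r / q) x1 IH => x x1; set y := x ^+ n => IH n0.
  have IH' : 0 <= y - (1 + n%:R * (x - 1)) by rewrite subr_ge0.
  have := mulr_ge0 (ltW x1) IH'; have := mulr_ge0 n0 (sqr_ge0 (x - 1)); nra.
have c0 : 0 <= c by apply: le_trans (rq 0); rewrite exprn_ge0 ?divr_ge0.
have := archi_boundP (divr_ge0 c0 (ltW x1)).
set k := Num.bound _; rewrite ltr_pdivrMr // => ck.
have := le_trans (bernoulli _) (rq k); rewrite leNgt => /negP[].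
apply: lt_trans ck _; rewrite ltr_wpDl // ltr_pM2r // ltr_nat.
exact: ltn_expl.
Qed.

Section MatrixNorm.
Variables (R : realType) (A : cstarAlgType R) (K : nat).
Variables (phi : 'M[R[i]]_K -> A).
Hypothesis phiE : unital_embedding phi.
Local Notation "x %:C" := (real_complex R x).

Lemma mulmx_ctr (v : 'rV[R[i]]_K) : v *m mxct v = (hs v)%:C%:M.
Proof. by rewrite [LHS]mx11_scalar hs_trace /mxtrace big_ord1. Qed.

Lemma nrm_delta (i : 'I_K) : nrm (phi (delta_mx i i)) = 1.
Proof.
set e := delta_mx i i.
have ee : adj e ** e = e.
  rewrite -[RHS](mul_delta_mx i i) -[LHS]/(mxct e *m e); congr (_ *m _).
  apply/matrixP => a b; rewrite !mxE andbC.
  by case: (_ && _); rewrite ?rmorph1 ?rmorph0.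
have : nrm (phi e) != 0.
  rewrite nrm_eq0; apply/eqP; rewrite -(emb0 phiE) => /(emb_inj phiE).
  move/matrixP/(_ i i)/eqP; rewrite !mxE !eqxx.
  by rewrite oner_eq0.
move=> e0; apply: (mulfI e0); rewrite mulr1 -expr2.
by rewrite -nrm_cstar -(emb_adj phiE) -(emb_mul phiE) ee.
Qed.

(* A matrix with a single nonzero row has the Euclidean norm of that row as its
   C*-norm; hence every C*-norm dominates the operator norm. *)
Lemma nrm_row i (v : 'rV[R[i]]_K) : nrm (phi (delta_mx i 0 *m v)) ^+ 2 = hs v.
Proof.
rewrite -nrm_cstar_r -(emb_adj phiE) -(emb_mul phiE).
have -> : (delta_mx i 0 *m v) ** adj (delta_mx i 0 *m v) =
          (hs v)%:C *: delta_mx i i :> 'M[R[i]]_K.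
  rewrite -[LHS]/(_ *m mxct _) mxctM -mulmxA (mulmxA v) mulmx_ctr mul_scalar_mx.
  rewrite -scalemxAr; congr (_ *: _).
  have -> : mxct (delta_mx i 0) = delta_mx 0 i :> 'rV[R[i]]_K.
    apply/matrixP => a b; rewrite !mxE andbC.
    by case: (_ && _); rewrite ?rmorph1 ?rmorph0.
  by rewrite mul_delta_mx.
by rewrite (emb_scale phiE) nrmZr ?hs_ge0 // nrm_delta mulr1.
Qed.

Lemma hs_row1 (i : 'I_K) : hs (row i (1%:M : 'M[R[i]]_K)) = 1.
Proof.
rewrite /hs big_ord1 (bigD1 i) //= !mxE eqxx big1 => [|l /negPf il].
  by rewrite mulr1n addr0 nsq1.
by rewrite !mxE eq_sym il mulr0n nsq0.
Qed.

Lemma hs_mulr_row (v : 'rV[R[i]]_K) y : hs (v *m y) <= nrm (phi y) ^+ 2 * hs v.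
Proof.
case: (pickP 'I_K) => [i _|K0]; last first.
  rewrite [hs v]/hs big_ord1 big1 ?mulr0 => [|j _]; last by have := K0 j.
  by rewrite [hs _]/hs big_ord1 big1 // => j _; have := K0 j.
rewrite -!(nrm_row i) mulmxA -exprMn ler_pXn2r ?nnegrE ?mulr_ge0 ?nrm_ge0 //.
by rewrite mulrC (emb_mul phiE (delta_mx i 0 *m v) y) nrmM.
Qed.

Lemma hs_mulr m (v : 'M[R[i]]_(m, K)) y :
  hs (v *m y) <= nrm (phi y) ^+ 2 * hs v.
Proof.
rewrite !hs_rows mulr_sumr ler_sum // => i _.
by rewrite row_mul hs_mulr_row.
Qed.

Lemma hs_mull m (v : 'M[R[i]]_(K, m)) y :
  hs (y *m v) <= nrm (phi y) ^+ 2 * hs v.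
Proof.
rewrite -hs_ct mxctM -(hs_ct v) (le_trans (hs_mulr _ _)) //.
by rewrite -[mxct y]/(adj y) (emb_adj phiE) nrm_adj.
Qed.

(** A crude bound, but its constant does not depend on [y], so [le_of_expn_bound] eliminates it in
    [nrm_le_herm]. *)
Lemma nrm_entries (y : 'M[R[i]]_K) (q : R) : 0 <= q ->
  (forall i j, nsq (y i j) <= q ^+ 2) ->
  nrm (phi y) <= (\sum_i \sum_j nrm (phi (delta_mx i j))) * q.
Proof.
move=> q0 yq; rewrite [y in phi y]matrix_sum_delta (emb_sum phiE) mulr_suml.
apply: le_trans (nrm_sum _ _ _) _; apply: ler_sum => i _.
rewrite (emb_sum phiE) mulr_suml.
apply: le_trans (nrm_sum _ _ _) _; apply: ler_sum => j _.
rewrite (emb_scale phiE) nrmZ mulrC ler_wpM2l ?nrm_ge0 //.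
by rewrite -[leRHS]ger0_norm // -sqrtr_sqr ler_wsqrtr.
Qed.

Lemma iter_sqr_herm (h : 'M[R[i]]_K) k : mxct h = h ->
  mxct (iter k (fun x => x *m x) h) = iter k (fun x => x *m x) h.
Proof. by move=> hh; elim: k => //= k IH; rewrite mxctM IH. Qed.

Lemma nrm_iter_sqr (h : 'M[R[i]]_K) k : mxct h = h ->
  nrm (phi (iter k (fun x => x *m x) h)) = nrm (phi h) ^+ (2 ^ k).
Proof.
move=> hh; elim: k => //= k IH.
set x := iter k _ h in IH *.
have -> : x *m x = adj x ** x.
  by rewrite -[adj x]/(mxct x) -[_ ** _]/(_ *m _) iter_sqr_herm.
by rewrite (emb_mul phiE) (emb_adj phiE) nrm_cstar IH -exprM -expnSr.
Qed.

Lemma hs_iter_sqr (h : 'M[R[i]]_K) (q : R) k : 0 <= q ->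
  (forall v : 'rV_K, hs (v *m h) <= q ^+ 2 * hs v) ->
  forall v : 'rV_K,
    hs (v *m iter k (fun x => x *m x) h) <= (q ^+ (2 ^ k)) ^+ 2 * hs v.
Proof.
move=> q0 hq; elim: k => //= k IH v.
rewrite mulmxA (le_trans (IH _)) // expnSr exprM [X in _ <= X * _]expr2
  -[leRHS]mulrA.
by rewrite ler_wpM2l ?sqr_ge0.
Qed.

(** The spectral radius argument: the norm of h^(2^k) is exactly the 2^k-th power of the norm of h,
    while its entries have modulus at most q^(2^k). Comparing growth rates gives the bound. *)
Lemma nrm_le_herm (h : 'M[R[i]]_K) (q : R) : 0 <= q -> mxct h = h ->
  (forall v : 'rV_K, hs (v *m h) <= q ^+ 2 * hs v) -> nrm (phi h) <= q.
Proof.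
move=> q0 hh hq.
apply: (@le_of_expn_bound _ _ _ (\sum_i \sum_j nrm (phi (delta_mx i j)))) => //.
  exact: nrm_ge0.
move=> k; rewrite -nrm_iter_sqr // nrm_entries ?exprn_ge0 // => i j.
set x := iter k _ h; rewrite -[x]mul1mx.
have := hs_iter_sqr k q0 hq (row i 1%:M); rewrite -row_mul -/x.
rewrite hs_row1 mulr1; apply: le_trans.
by have := nsq_le_hs (row i (1%:M *m x)) 0 j; rewrite mxE.
Qed.

(** Submultiplicativity in disguise: the matrix with row [v] in position i has squared norm [hs v],
    and multiplying [w] by its adjoint gives a row whose entry i is the inner product. *)
Lemma cauchy_schwarz (v w : 'rV[R[i]]_K) :
  nsq ((w *m mxct v) 0 0) <= hs w * hs v.
Proof.
case: (pickP 'I_K) => [i _|K0]; last first.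
  rewrite mxE big1 => [|j _]; last by have := K0 j.
  by rewrite nsq0 mulr_ge0 ?hs_ge0.
have := hs_mulr_row w (mxct (delta_mx i 0 *m v)).
rewrite -[mxct (_ *m v)]/(adj (delta_mx i 0 *m v)) (emb_adj phiE) nrm_adj
  nrm_row mulrC.
apply: le_trans; rewrite -[adj _]/(mxct _) mxctM mulmxA.
apply: le_trans (nsq_le_hs _ 0 i); rewrite [w *m mxct v]mx11_scalar.
rewrite mul_scalar_mx !mxE !eqxx mulr1n nsqM.
by rewrite conjC1 nsq1 mulr1.
Qed.

Lemma nrm_le_opbound (y : 'M[R[i]]_K) (q : R) : 0 <= q ->
  (forall v : 'rV_K, hs (v *m y) <= q ^+ 2 * hs v) -> nrm (phi y) <= q.
Proof.
move=> q0 yq.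
(* The bound passes to the adjoint: [hs w] is the inner product of [w *m y] with [v], so
   Cauchy-Schwarz gives (hs w)^2 <= q^2 (hs w) (hs v). The hermitian matrix [y *m mxct y] then
   satisfies the bound q^2, and the C*-identity takes the square root. *)
have ctq (v : 'rV_K) : hs (v *m mxct y) <= q ^+ 2 * hs v.
  set w := v *m mxct y.
  have [->|w0] := eqVneq (hs w) 0; first by rewrite mulr_ge0 ?sqr_ge0 ?hs_ge0.
  have w_gt0 : 0 < hs w by rewrite lt_def w0 hs_ge0.
  have E : (w *m y *m mxct v) 0 0 = (hs w)%:C.
    rewrite hs_trace /mxtrace big_ord1; congr (_ 0 0).
    by rewrite {2}/w mxctM mxctK mulmxA.
  have := cauchy_schwarz v (w *m y); rewrite E nsq_real => cs.
  rewrite -(ler_pM2l w_gt0) -expr2 (le_trans cs) //.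
  by rewrite mulrA [hs w * _]mulrC ler_wpM2r ?hs_ge0.
rewrite -(ler_pXn2r (n := 2)) ?nnegrE ?nrm_ge0 //.
rewrite -nrm_cstar_r -(emb_adj phiE) -(emb_mul phiE).
apply: nrm_le_herm; first by rewrite sqr_ge0.
  by rewrite -[_ ** _]/(y *m mxct y) mxctM mxctK.
move=> v; rewrite -[_ ** _]/(y *m mxct y) mulmxA (le_trans (ctq _)) //.
by rewrite [X in _ <= X * _]expr2 -[leRHS]mulrA ler_wpM2l ?sqr_ge0.
Qed.

End MatrixNorm.

(** Uniqueness of the C*-norm on a matrix algebra: each of the two norms is an operator bound by
    [hs_mulr_row], and is dominated by every operator bound by [nrm_le_opbound]. *)
Lemma emb_isometry (R : realType) (A B : cstarAlgType R) K
    (phi : 'M[R[i]]_K -> A) (psi : 'M[R[i]]_K -> B) :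
  unital_embedding phi -> unital_embedding psi ->
  forall y, nrm (phi y) = nrm (psi y).
Proof.
move=> phiE psiE y; apply/eqP; rewrite eq_le.
rewrite (nrm_le_opbound phiE (nrm_ge0 _)) => [|v]; last exact: hs_mulr_row.
by rewrite (nrm_le_opbound psiE (nrm_ge0 _)) => // v; exact: hs_mulr_row.
Qed.

(** * Inflation of matrices along index splittings *)

Section IndexSplitting.

(** A bijection [n] = [m] x [d]. Plain functions on [nat], constrained only below the bounds, avoid
    casts between ordinals of provably equal sizes when splittings are composed and regrouped. *)
Record index_split (m d n : nat) (s t : nat -> nat) (p : nat -> nat -> nat) :
  Prop := IndexSplit {
  split_fst : forall x, (x < n)%N -> (s x < m)%N;
  split_snd : forall x, (x < n)%N -> (t x < d)%N;
  split_pair : forall i e, (i < m)%N -> (e < d)%N -> (p i e < n)%N;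
  split_fstK : forall i e, (i < m)%N -> (e < d)%N -> s (p i e) = i;
  split_sndK : forall i e, (i < m)%N -> (e < d)%N -> t (p i e) = e;
  split_pairK : forall x, (x < n)%N -> p (s x) (t x) = x
}.

Lemma split_sum (V : nmodType) m d n s t p (F : nat -> V) :
  index_split m d n s t p ->
  \sum_(x < n) F x = \sum_(i < m) \sum_(e < d) F (p i e).
Proof.
move=> sp; rewrite pair_big /=.
pose h (ie : 'I_m * 'I_d) :=
  Ordinal (split_pair sp (ltn_ord ie.1) (ltn_ord ie.2)).
pose g (x : 'I_n) := (Ordinal (split_fst sp (ltn_ord x)),
                      Ordinal (split_snd sp (ltn_ord x))).
rewrite (reindex h) //; exists g => [[i e] _|x _].
  by congr pair; apply: val_inj; rewrite /= ?(split_fstK sp) ?(split_sndK sp).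
by apply: val_inj; rewrite /= (split_pairK sp).
Qed.

Lemma split_size m d n s t p : index_split m d n s t p -> n = (m * d)%N.
Proof.
move=> sp; have := split_sum (V := nat) (fun=> 1) sp.
by rewrite !sumr_const !card_ord -mulrnA !natn mulnC.
Qed.

Lemma divmod_eq d x y a b : (a < d)%N -> (b < d)%N ->
  ((x * d + a)%N == (y * d + b)%N) = (x == y) && (a == b).
Proof.
move=> ad bd; apply/eqP/andP => [E|[/eqP-> /eqP->] //].
have d0 : (0 < d)%N by apply: leq_ltn_trans ad.
have := congr1 (divn^~ d) E; have := congr1 (modn^~ d) E.
rewrite /= !modnMDl !divnMDl // !modn_small // !divn_small // !addn0.
by move=> -> ->.
Qed.

(** The two multiplicity labels are coded as one number whose low digit, in base d, is the inner
    label. Thus a fixed outer label is a block of d consecutive numbers, which the regrouping relies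
    on. *)
Lemma split_comp m d n k q s t p s' t' p' :
  index_split m d n s t p -> index_split n k q s' t' p' ->
  index_split m (d * k) q (s \o s') (fun x => (t' x * d + t (s' x))%N)
    (fun i e => p' (p i (e %% d)%N) (e %/ d)%N).
Proof.
move=> sp sp'.
have pe i e : (i < m)%N -> (e < d * k)%N ->
    [/\ (e %% d < d)%N, (e %/ d < k)%N & (p i (e %% d) < n)%N].
  move=> im ed; have d0 : (0 < d)%N by case: d ed {sp}.
  have ed' : (e %% d < d)%N by rewrite ltn_mod.
  by split; rewrite ?ltn_divLR // 1?mulnC // (split_pair sp).
split=> [x xq|x xq|i e im ed|i e im ed|i e im ed|x xq] /=.
- by rewrite (split_fst sp) ?(split_fst sp').
- have := split_snd sp' xq; have := split_snd sp (split_fst sp' xq).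
  set a := t _; set b := t' x => ad bk.
  apply: (@leq_trans (b.+1 * d)%N); first by rewrite mulSn addnC ltn_add2r.
  by rewrite mulnC leq_mul2l bk orbT.
- by have [e1 e2 e3] := pe _ _ im ed; rewrite (split_pair sp').
- by have [e1 e2 e3] := pe _ _ im ed; rewrite (split_fstK sp') ?(split_fstK sp).
- have [e1 e2 e3] := pe _ _ im ed.
  by rewrite (split_fstK sp') ?(split_sndK sp) ?(split_sndK sp') // -divn_eq.
- have := split_snd sp (split_fst sp' xq) => ad.
  have d0 : (0 < d)%N by apply: leq_ltn_trans ad.
  rewrite modnMDl modn_small // divnMDl // divn_small // addn0.
  by rewrite (split_pairK sp) ?(split_pairK sp') // (split_fst sp').
Qed.

Lemma split_refl n : index_split n 1 n id (fun=> 0%N) (fun i _ => i).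
Proof. by split=> // i [|]. Qed.

Lemma split_divmod m k : (0 < k)%N ->
  index_split m k (m * k) (divn^~ k) (modn^~ k) (fun i e => (i * k + e)%N).
Proof.
move=> k0; split=> [x|x|i e im ek|i e im ek|i e im ek|x xm] /=.
- by rewrite ltn_divLR.
- by rewrite ltn_mod.
- apply: (@leq_trans (i.+1 * k)%N); first by rewrite mulSn addnC ltn_add2r.
  by rewrite leq_mul2r im orbT.
- by rewrite divnMDl // divn_small // addn0.
- by rewrite modnMDl modn_small.
- by rewrite -divn_eq.
Qed.

(** The label in [l * e] is cut in base l: its low digit joins the index in [m] to form one in [m'],
    and its high digit remains as the label. *)
Lemma split_assoc m l m' e n s t p s' t' p' :
  index_split m l m' s' t' p' -> index_split m (l * e) n s t p ->
  index_split m' e n (fun x => p' (s x) (t x %% l)%N) (fun x => (t x %/ l)%N)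
    (fun i f => p (s' i) (f * l + t' i)%N).
Proof.
move=> sp' sp.
have l0 x : (x < n)%N -> (0 < l)%N.
  by move=> xn; have := split_snd sp xn; case: (l).
have lt i f : (i < m')%N -> (f < e)%N -> (f * l + t' i < l * e)%N.
  move=> im fe; have := split_snd sp' im => il.
  apply: (@leq_trans (f.+1 * l)%N); first by rewrite mulSn addnC ltn_add2r.
  by rewrite mulnC leq_mul2l fe orbT.
split=> [x xn|x xn|i f im fe|i f im fe|i f im fe|x xn] /=.
- by rewrite (split_pair sp') ?(split_fst sp) ?ltn_mod ?(l0 x).
- by rewrite ltn_divLR ?(l0 x) // mulnC (split_snd sp).
- by rewrite (split_pair sp) ?(split_fst sp') ?lt.
- have := split_snd sp' im => il.
  rewrite (split_fstK sp) ?(split_sndK sp) ?lt ?(split_fst sp') //.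
  by rewrite modnMDl modn_small ?(split_pairK sp').
- have := split_snd sp' im => il; have l1 := leq_ltn_trans (leq0n _) il.
  rewrite (split_sndK sp) ?lt ?(split_fst sp') //.
  by rewrite divnMDl // divn_small // addn0.
- have sx := split_fst sp xn;
  have tl : (t x %% l < l)%N by rewrite ltn_mod (l0 x).
  by rewrite (split_fstK sp') ?(split_sndK sp') // -divn_eq (split_pairK sp).
Qed.

End IndexSplitting.

Section Entries.
Variable R : realType.
Local Notation C := R[i].

Definition ent m n (a : 'M[C]_(m, n)) (i j : nat) : C :=
  if (insub i, insub j) is (Some i', Some j') then a i' j' else 0.

Lemma entE m n (a : 'M[C]_(m, n)) (i : 'I_m) (j : 'I_n) : ent a i j = a i j.
Proof. by rewrite /ent !valK. Qed.

Lemma ent_ord m n (a : 'M[C]_(m, n)) x y (xm : (x < m)%N) (yn : (y < n)%N) :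
  ent a x y = a (Ordinal xm) (Ordinal yn).
Proof. by rewrite -entE. Qed.

Lemma ent_inj m n (a b : 'M[C]_(m, n)) :
  (forall i j, (i < m)%N -> (j < n)%N -> ent a i j = ent b i j) -> a = b.
Proof. by move=> ab; apply/matrixP => i j; rewrite -!entE ab. Qed.

Lemma ent_matrix m n (F : nat -> nat -> C) i j : (i < m)%N -> (j < n)%N ->
  ent (\matrix_(i' < m, j' < n) F i' j') i j = F i j.
Proof. by move=> im jn; rewrite ent_ord mxE. Qed.

Lemma ent_mul m n q (a : 'M[C]_(m, n)) (b : 'M[C]_(n, q)) i j :
  (i < m)%N -> (j < q)%N ->
  ent (a *m b) i j = \sum_(k < n) ent a i k * ent b k j.
Proof.
move=> im jn; rewrite ent_ord mxE.
by apply: eq_bigr => k _; rewrite -!entE.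
Qed.

Lemma ent1 m i j : (i < m)%N -> (j < m)%N ->
  ent (1%:M : 'M[C]_m) i j = (i == j)%:R.
Proof. by move=> im jn; rewrite ent_ord mxE. Qed.

Lemma ent_ct m n (a : 'M[C]_(m, n)) i j : (i < n)%N -> (j < m)%N ->
  ent (mxct a) i j = Num.conj (ent a j i).
Proof. by move=> im jn; rewrite !ent_ord !mxE. Qed.

Lemma entD m n (a b : 'M[C]_(m, n)) i j : (i < m)%N -> (j < n)%N ->
  ent (a + b) i j = ent a i j + ent b i j.
Proof. by move=> im jn; rewrite !ent_ord !mxE. Qed.

Lemma entZ m n (a : C) (b : 'M[C]_(m, n)) i j : (i < m)%N -> (j < n)%N ->
  ent (a *: b) i j = a * ent b i j.
Proof. by move=> im jn; rewrite !ent_ord !mxE. Qed.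

Lemma hs_ent m n (a : 'M[C]_(m, n)) :
  hs a = \sum_(i < m) \sum_(j < n) nsq (ent a i j).
Proof. by apply: eq_bigr => i _; apply: eq_bigr => j _; rewrite entE. Qed.

(* For an index splitting (s, t) this is [a |-> a (x) 1] in the basis indexed
   by [x <-> (s x, t x)]. *)
Definition infl (s t : nat -> nat) m n (a : 'M[C]_m) : 'M[C]_n :=
  \matrix_(x < n, y < n) (ent a (s x) (s y) *+ (t x == t y)).

Arguments infl s t {m n} a.

Section Inflation.
Variables (m d n : nat) (s t : nat -> nat) (p : nat -> nat -> nat).
Hypothesis sp : index_split m d n s t p.
Local Notation iota := (@infl s t m n).

Lemma ent_infl a x y : (x < n)%N -> (y < n)%N ->
  ent (iota a) x y = ent a (s x) (s y) *+ (t x == t y).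
Proof. exact: (ent_matrix (fun x y => ent a (s x) (s y) *+ (t x == t y))). Qed.

Lemma infl_emb : (0 < d)%N -> unital_embedding iota.
Proof.
move=> d0; split=> [a b|c a|a b||a|a b ab].
- apply: ent_inj => x y xn yn; rewrite entD // !ent_infl //.
  by rewrite entD ?(split_fst sp) // mulrnDl.
- apply: ent_inj => x y xn yn; rewrite entZ // !ent_infl //.
  by rewrite entZ ?(split_fst sp) // mulrnAr.
- rewrite -[_ ** _]/(_ *m _) -[iota a ** _]/(_ *m _).
  apply: ent_inj => x y xn yn;
    rewrite ent_mul // ent_infl // ent_mul ?(split_fst sp) //.
  rewrite (split_sum (fun k => ent (iota a) x k * ent (iota b) k y) sp).
  rewrite -sumrMnl; apply: eq_bigr => i _.
  rewrite (bigD1 (Ordinal (split_snd sp xn))) //= big1 ?addr0 => [|e ne].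
    have tx := split_snd sp xn; have pn := split_pair sp (ltn_ord i) tx.
    rewrite !ent_infl // !(split_fstK sp) // !(split_sndK sp) // eqxx mulr1n.
    by rewrite mulrnAr.
  have pn := split_pair sp (ltn_ord i) (ltn_ord e).
  rewrite ent_infl // (split_sndK sp) //.
  have /negPf -> : t x != e by apply: contraNneq ne => E; apply/eqP/val_inj.
  by rewrite mulr0n mul0r.
- rewrite -[sone]/(1%:M : 'M[C]_m) -[sone]/(1%:M : 'M[C]_n).
  apply: ent_inj => x y xn yn; rewrite ent_infl // !ent1 ?(split_fst sp) //.
  rewrite -mulrnA mulnb; congr (nat_of_bool _)%:R.
  apply/andP/eqP => [[/eqP sxy /eqP txy]|-> //].
  by rewrite -(split_pairK sp xn) -(split_pairK sp yn) sxy txy.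
- rewrite -[adj a]/(mxct a) -[adj (iota a)]/(mxct (iota a)).
  apply: ent_inj => x y xn yn;
    rewrite ent_ct // !ent_infl // ent_ct ?(split_fst sp) //.
  by rewrite rmorphMn eq_sym.
(* Injectivity: each entry of [a] reappears between the indices with label 0, a valid label since 0
   < d. *)
- apply: ent_inj => i j im jm.
  have pin := split_pair sp im d0; have pjn := split_pair sp jm d0.
  have := congr1 (fun z => ent z (p i 0) (p j 0)) ab.
  by rewrite /= !ent_infl // !(split_fstK sp) // !(split_sndK sp) // eqxx.
Qed.

(** Since the size also grows by the factor d, the quotient of [hs] by the size is invariant; this
    replaces invariance of the normalised trace. *)
Lemma hs_infl a : hs (iota a) = d%:R * hs a.
Proof.
rewrite !hs_ent (split_sum (fun x => \sum_(j < n) nsq (ent (iota a) x j)) sp).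
rewrite mulr_sumr; apply: eq_bigr => i _.
rewrite mulr_natl -[X in _ *+ X]card_ord -sumr_const; apply: eq_bigr => e _.
rewrite (split_sum (fun y => nsq (ent (iota a) (p i e) y)) sp).
apply: eq_bigr => j _; rewrite (bigD1 e) //= big1 ?addr0 => [|f fe].
  rewrite ent_infl ?(split_pair sp) // !(split_fstK sp) // !(split_sndK sp) //.
  by rewrite eqxx.
rewrite ent_infl ?(split_pair sp) // !(split_sndK sp) //.
have /negPf -> : (val e != val f) by apply: contraNneq fe => E;
  apply/eqP/val_inj.
by rewrite mulr0n nsq0.
Qed.

End Inflation.

Lemma infl_comp m d n k q s t p s' t' p' (a : 'M[C]_m) :
  index_split m d n s t p -> index_split n k q s' t' p' ->
  infl s' t' (infl s t a : 'M[C]_n) =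
  infl (s \o s') (fun x => (t' x * d + t (s' x))%N) a :> 'M[C]_q.
Proof.
move=> sp sp'; apply: ent_inj => x y xq yq;
  rewrite !ent_infl ?(split_fst sp') //=.
by rewrite divmod_eq ?(split_snd sp) ?(split_fst sp') // -mulrnA mulnb andbC.
Qed.

Lemma eq_infl m n s t s' t' (a : 'M[C]_m) :
  (forall x, (x < n)%N -> s x = s' x) ->
  (forall x y, (x < n)%N -> (y < n)%N -> (t x == t y) = (t' x == t' y)) ->
  infl s t a = infl s' t' a :> 'M[C]_n.
Proof.
by move=> ss tt; apply: ent_inj => x y xn yn; rewrite !ent_infl // tt // !ss.
Qed.

End Entries.

Arguments infl {R} s t {m n} a.

(** * Towers of matrix algebras *)

Section Towers.
Variables (R : realType) (A : cstarAlgType R).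
Local Notation C := R[i].

(* An increasing sequence of full matrix subalgebras with dense union, the
   inclusions being inflations along index splittings. *)
Record tower (K : nat -> nat) (phi : forall n, 'M[C]_(K n) -> A)
    (k : nat -> nat) (s t : nat -> nat -> nat) (p : nat -> nat -> nat -> nat) :
  Prop := Tower {
  tower_gt0 : forall n, (0 < K n)%N;
  tower_emb : forall n, unital_embedding (phi n);
  tower_split : forall n, index_split (K n) (k n) (K n.+1) (s n) (t n) (p n);
  tower_infl : forall n a, phi n.+1 (infl (s n) (t n) a) = phi n a;
  tower_dense : forall x e, 0 < e -> exists n a, nrm (phi n a - x) < e
}.

Lemma closure_nrm (X : set A) x (e : R) : closure X x -> 0 < e ->
  exists2 y, X y & nrm (y - x) < e.
Proof.
move=> Xx e0; have e0' : 0 < (real_complex R e) by rewrite ltcR.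
have [y [Xy]] := Xx _ (nbhsx_ballx x _ e0').
by rewrite -ball_normE /= nrmE ltcR nrmB => xy; exists y.
Qed.

Lemma uhf_tower : UHF A ->
  exists k phi s t p, (forall n, (2 <= k n)%N) /\
    @tower (tensor_size k) phi k s t p.
Proof.
move=> [k [k2 [phi [phiE phi_tens phi_dense]]]].
exists k, phi, (fun n => divn^~ (k n)), (fun n => modn^~ (k n)).
exists (fun n i e => (i * k n + e)%N); split=> //; split=> //.
- by elim=> //= n IH; rewrite muln_gt0 IH (leq_trans _ (k2 n)).
- by move=> n; apply: split_divmod; rewrite (leq_trans _ (k2 n)).
- move=> n a; rewrite -[RHS]phi_tens; apply: (congr1 (phi n.+1)).
  apply/matrixP => x y; rewrite -[LHS]entE ent_infl ?ltn_ord // !mxE.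
  rewrite mulr_natr -entE /=; congr (_ *+ _).
- move=> x e e0; have cx : closure (\bigcup_n range (phi n)) x by rewrite
  phi_dense.
  by have [y [n _ [a _ <-]] xy] := closure_nrm cx e0; exists n, a.
Qed.

Variables (K : nat -> nat) (phi : forall n, 'M[C]_(K n) -> A).
Arguments phi : clear implicits.
Variables (k : nat -> nat) (s t : nat -> nat -> nat) (p : nat -> nat -> nat ->
  nat).
Hypothesis tw : tower phi k s t p.

Lemma tower_mul_gt0 n : (0 < k n)%N.
Proof.
have := tower_gt0 tw n.+1.
by rewrite (split_size (tower_split tw n)) muln_gt0 => /andP[].
Qed.

Lemma tower_le i j : (i <= j)%N -> exists d s' t' p',
  [/\ (0 < d)%N, index_split (K i) d (K j) s' t' p' &
      forall a : 'M[C]_(K i), phi j (infl s' t' a) = phi i a].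
Proof.
have base n : exists d s' t' p', [/\ (0 < d)%N,
    index_split (K n) d (K n) s' t' p' &
    forall a : 'M[C]_(K n), phi n (infl s' t' a) = phi n a].
  exists 1%N, id, (fun=> 0%N), (fun i _ => i).
  split=> [//||a]; first exact: split_refl.
  by apply: (congr1 (phi n)); apply: ent_inj => x y xn yn; rewrite ent_infl.
elim: j => [|j IH]; first by rewrite leqn0 => /eqP ->; exact: base.
rewrite leq_eqVlt => /predU1P[->|]; first exact: base.
move=> /IH [d [s' [t' [p' [d0 sp E]]]]].
have sp' := split_comp sp (tower_split tw j).
do 4!eexists; split; [|exact: sp'|].
  by rewrite muln_gt0 d0 tower_mul_gt0.
by move=> a; rewrite -(infl_comp _ sp (tower_split tw j)) (tower_infl tw) E.
Qed.

Lemma tower_approx x e : 0 < e ->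
  exists i, forall j, (i <= j)%N -> exists a, nrm (phi j a - x) < e.
Proof.
move=> e0; have [i [a ax]] := tower_dense tw x e0; exists i => j ij.
have [d [s' [t' [p' [_ _ E]]]]] := tower_le ij.
by exists (infl s' t' a); rewrite E.
Qed.

Lemma tower_subseq (h : nat -> nat) : (forall n, (h n < h n.+1)%N) ->
  exists k' s' t' p',
    @tower (K \o h) (fun n => phi (h n)) k' s' t' p'.
Proof.
move=> hh; have /choice[f fP] : forall n, exists f : nat * (nat -> nat) *
    (nat -> nat) * (nat -> nat -> nat),
    index_split (K (h n)) f.1.1.1 (K (h n.+1)) f.1.1.2 f.1.2 f.2 /\
    forall a : 'M[C]_(K (h n)), phi (h n.+1) (infl f.1.1.2 f.1.2 a) = phi (h n)
      a.
  move=> n; have [d [s' [t' [p' [d0 sp E]]]]] := tower_le (ltnW (hh n)).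
  by exists (d, s', t', p').
exists (fun n => (f n).1.1.1), (fun n => (f n).1.1.2), (fun n => (f n).1.2).
exists (fun n => (f n).2); split=> [n|n|n|n a|x e e0] /=.
- exact: tower_gt0 tw _.
- exact: tower_emb tw _.
- by have [] := fP n.
- by have [_ ->] := fP n.
- have [i ix] := tower_approx x e0.
  have ih n : (n <= h n)%N.
    by elim: n => // n IH; apply: leq_ltn_trans (hh n).
  by have [a ax] := ix _ (ih i); exists i, a.
Qed.

End Towers.

(** * Matrix subalgebras and divisibility *)

Section SpectralProjection.
Variables (R : realType) (A : cstarAlgType R) (K : nat).
Local Notation C := R[i].
Variables (phi : 'M[C]_K -> A).
Hypothesis phiE : unital_embedding phi.

Lemma hs_unitary m (v : 'M[C]_(m, K)) (U : 'M[C]_K) :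
  U *m mxct U = 1%:M -> hs (v *m U) = hs v.
Proof.
move=> UU; apply: (@complexI R); rewrite !hs_trace mxctM.
by rewrite mulmxA -(mulmxA v) UU mulmx1.
Qed.

Lemma mulmx_diag_row (v : 'rV[C]_K) (D : 'rV[C]_K) j :
  (v *m diag_mx D) 0 j = v 0 j * D 0 j.
Proof. by rewrite mul_mx_diag !mxE. Qed.

Lemma conj_idempotent n (P D : 'M[C]_n) : P \in unitmx -> D *m D = D ->
  (invmx P *m D *m P) *m (invmx P *m D *m P) = invmx P *m D *m P.
Proof.
by move=> Pu DD; rewrite !mulmxA mulmxK // -(mulmxA (invmx P) D D) DD.
Qed.

(* If [h ^ 2] is close to [h], the eigenvalues of [h] are close to 0 or 1; [q]
   is the spectral projection for those close to 1. *)
Lemma spectral_projection (h : 'M[C]_K) (e : R) : 0 <= e -> mxct h = h ->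
  nrm (phi (h *m h - h)) <= e ->
  exists q : 'M[C]_K, q *m q = q /\ nrm (phi (q - h)) <= 2 * e.
Proof.
move=> e0 hh hhe.
have hnormal : h \is normalmx.
  by apply/normalmxP; rewrite -map_trmx -[_^T]/(mxct h) hh.
have /orthomx_spectralP := hnormal.
set P := spectralmx h; set D := spectral_diag h => hE.
have Pu : P \in unitmx := spectral_unit h.
have PP : P *m mxct P = 1%:M.
  have /unitarymxP := spectral_unitarymx h.
  by rewrite -map_trmx.
(* The cut is at modulus 1/2: for each eigenvalue x, x or x - 1 has modulus at least 1/2 and the
   other one is the error, so the error is at most 2 |x| |x - 1|. This is the factor 2 of the
   statement. *)
pose chi : 'rV[C]_K := \row_j (if 4^-1 <= nsq (D 0 j) then 1 else 0).
pose q := invmx P *m diag_mx chi *m P.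
have Dj j : nsq (chi 0 j - D 0 j) <= (2 * e) ^+ 2.
  (* Row j of [P] is a unit left eigenvector of [h], so the norm of [h *m h - h] bounds the scalar
     by which it acts on that row. *)
  have : nsq (D 0 j ^+ 2 - D 0 j) <= e ^+ 2.
    have hs1 : hs (row j P) = 1.
      apply: (@complexI R); rewrite hs_trace /mxtrace big_ord1 rmorph1.
      have := congr1 (fun M : 'M[C]_K => M j j) PP;
        rewrite !mxE eqxx mulr1n => <-.
      by apply: eq_bigr => l _; rewrite !mxE.
    have rh : row j P *m h = D 0 j *: row j P.
      rewrite -row_mul [X in P *m X]hE !mulmxA mulmxV // mul1mx.
      by apply/rowP => l; rewrite mul_diag_mx !mxE.
    have : row j P *m (h *m h - h) = (D 0 j ^+ 2 - D 0 j) *: row j P.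
      by rewrite mulmxBr mulmxA rh -scalemxAl rh scalerA scalerBl expr2.
    move=> rhh; have := hs_mulr phiE (row j P) (h *m h - h);
      rewrite rhh hs1 mulr1.
    have -> : hs ((D 0 j ^+ 2 - D 0 j) *: row j P) = nsq (D 0 j ^+ 2 - D 0 j).
      rewrite -[RHS]mulr1 -hs1 /hs !big_ord1 mulr_sumr.
      by apply: eq_bigr => l _; rewrite !mxE nsqM.
    move=> /le_trans; apply; rewrite ler_pXn2r ?nnegrE ?nrm_ge0 //.
  rewrite mxE; have -> : D 0 j ^+ 2 - D 0 j = D 0 j * (D 0 j - 1).
    by rewrite mulrBr mulr1 expr2.
  rewrite nsqM exprMn; have := nsq_ge0 (D 0 j); have := nsq_ge0 (D 0 j - 1).
  case: ifPn => [le|]; last rewrite -ltNge => lt.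
    by rewrite -(nsqN (1 - _)) opprB; move: le; nra.
  rewrite sub0r nsqN; have : 4^-1 <= nsq (D 0 j - 1).
    move: lt; case: (D 0 j) => a b; rewrite /nsq /= oppr0 addr0; nra.
  nra.
exists q; split.
  apply: conj_idempotent => //; apply/matrixP => i j; rewrite mul_mx_diag !mxE.
  by case: eqP => [->|]; rewrite ?mul0r // !mulr1n; case: ifP;
    rewrite ?mulr1 ?mulr0.
apply: nrm_le_opbound => // [|v]; first by rewrite mulr_ge0.
have -> : q - h = invmx P *m diag_mx (chi - D) *m P.
  by rewrite hE raddfB /= mulmxBr mulmxBl.
rewrite !mulmxA hs_unitary //.
rewrite -{2}(mulmxKV Pu v) (hs_unitary _ PP).
set w := v *m invmx P; rewrite /hs !big_ord1 mulr_sumr ler_sum // => j _.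
by rewrite mulmx_diag_row nsqM mulrC !mxE ler_wpM2r ?nsq_ge0 //; have := Dj j;
  rewrite !mxE.
Qed.

End SpectralProjection.

Lemma le0_of_contraction (R : realFieldType) (x y : R) :
  x < 1 -> y <= x * y -> y <= 0.
Proof.
move=> x1 yx; rewrite -(nmulr_rge0 _ (_ : x - 1 < 0)) ?subr_lt0 //.
by rewrite mulrBl mul1r subr_ge0.
Qed.

Section Divisibility.
Variables (R : realType) (A : cstarAlgType R).
Local Notation C := R[i].

Lemma hs_sum m n (I : Type) (r : seq I) (F : I -> 'M[C]_(m, n)) :
  hs (\sum_(l <- r) F l) <= 2 ^+ size r * \sum_(l <- r) hs (F l).
Proof.
elim: r => [|l r IH]; first by rewrite !big_nil hs0 mulr0.
rewrite !big_cons /= (le_trans (hsD _ _)) // exprS -mulrA mulrDr.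
rewrite mulrDr lerD //; last by rewrite ler_wpM2l.
rewrite ler_wpM2l // ler_peMl ?hs_ge0 // exprn_ege1 //.
by rewrite ler1n.
Qed.

Section Rank.
Variables (K L : nat) (phi : 'M[C]_K -> A).
Hypothesis phiE : unital_embedding phi.
Variables (q : 'M[C]_K) (T : 'I_L -> 'M[C]_K) (e c : R).
Hypothesis qq : q *m q = q.
Hypothesis Te : forall l l',
  nrm (phi (T l *m mxct (T l') - (if l == l' then q else 0))) <= e.
Hypothesis e0 : 0 <= e.
Hypothesis eL : L%:R * 2 ^+ L * e ^+ 2 < 1.
Hypothesis Tc : nrm (phi (1%:M - \sum_l mxct (T l) *m q *m T l)) <= c.
Hypothesis c1 : c < 1.

(* The [T l] are approximate partial isometries from the range of [q] onto
   almost orthogonal subspaces that together fill the whole space. *)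
Lemma rank_partial_isometries : (L * \rank q)%N = K.
Proof.
set Q := row_base q.
have [D qD] : exists D, q = D *m Q.
  by apply/submxP; rewrite eq_row_base.
have Qq : Q *m q = Q.
  have /submxP[E QE] : (Q <= q)%MS by rewrite eq_row_base.
  by rewrite QE -mulmxA qq.
(* [Z] has L * rank q rows and K columns: independence of the rows gives one inequality, and an
   invertible matrix factoring through [Z] gives the other. *)
pose Z := \mxcol_(l < L) (Q *m T l).
have Zfree : row_free Z.
  apply: inj_row_free => v; rewrite -{1}(submxrowK v) mul_mxrow_mxcol => vZ.
  pose w l := submxrow v l *m Q.
  have wq l : w l *m q = w l by rewrite -mulmxA Qq.
  have wT : \sum_l w l *m T l = 0.
    by rewrite -[RHS]vZ; apply: eq_bigr => l _; rewrite mulmxA.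
  (* Multiplying the relation by the adjoint of [T l'] recovers [w l'] up to the errors in the
     orthogonality relations. Summed over l', this bounds the total by L 2^L e^2 < 1 times itself,
     so it vanishes. *)
  have w_le l' : hs (w l') <= 2 ^+ L * e ^+ 2 * \sum_l hs (w l).
    have -> : w l' =
        - \sum_l w l *m (T l *m mxct (T l') - (if l == l' then q else 0)).
      under eq_bigr do rewrite mulmxBr mulmxA.
      rewrite sumrB -mulmx_suml wT mul0mx sub0r opprK (bigD1 l') //= eqxx wq.
      by rewrite big1 ?addr0 // => l /negPf ->; rewrite mulmx0.
    rewrite hsN (le_trans (hs_sum _ _)) // /index_enum -enumT size_enum_ord.
    rewrite -mulrA ler_wpM2l ?exprn_ge0 // mulr_sumr ler_sum // => l _.
    rewrite (le_trans (hs_mulr phiE _ _)) // ler_wpM2r ?hs_ge0 //.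
    by rewrite ler_pXn2r ?nnegrE ?nrm_ge0.
  have S0 : \sum_l hs (w l) = 0.
    have S_ge0 : 0 <= \sum_l hs (w l) by rewrite sumr_ge0 // => l _;
      exact: hs_ge0.
    have : \sum_l hs (w l) <= L%:R * (2 ^+ L * e ^+ 2 * \sum_l hs (w l)).
      rewrite mulr_natl -[X in _ *+ X]card_ord -sumr_const.
      by apply: ler_sum => l _; exact: w_le.
    rewrite mulrA (mulrA L%:R) => S_le; apply/eqP; rewrite eq_le S_ge0 andbT.
    exact: (le0_of_contraction eL S_le).
  have w0 l : w l = 0.
    apply: hs_eq0; rewrite -S0 (bigD1 l) //= lerDl sumr_ge0 // => l' _.
    exact: hs_ge0.
  have v0 l : submxrow v l = 0.
    have : w l = 0 *m Q by rewrite mul0mx w0.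
    by move/(row_free_inj (row_base_free q)).
  rewrite -(submxrowK v) -[RHS](@mxrow0 _ _ (fun=> _)).
  by apply: eq_mxrow => l; rewrite v0.
have rkZ : \rank Z = (L * \rank q)%N.
  by move/eqP: Zfree => ->; rewrite sum_nat_const card_ord.
apply/eqP; rewrite eqn_leq -{1}rkZ rank_leq_col /=.
(* At distance less than 1 from the identity, hence of full rank K. *)
pose M := \sum_l mxct (T l) *m q *m T l.
have MZ : M = (\mxrow_l (mxct (T l) *m D)) *m Z.
  rewrite mul_mxrow_mxcol; apply: eq_bigr => l _.
  by rewrite {1}qD !mulmxA.
have Mfree : row_free M.
  apply: inj_row_free => v vM; apply: hs_eq0.
  have := hs_mulr phiE v (1%:M - M); rewrite mulmxBr mulmx1 vM subr0.
  apply: le0_of_contraction; rewrite expr_lt1 ?nrm_ge0 //.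
  exact: le_lt_trans Tc c1.
by rewrite -rkZ -{1}(eqP Mfree) MZ mxrankM_maxr.
Qed.

End Rank.
End Divisibility.

Lemma nrm_distM_le (R : realType) (A : cstarAlgType R) (x y x' y' : A) a b c d :
  nrm (x - x') <= a -> nrm y <= b -> nrm x' <= c -> nrm (y - y') <= d ->
  nrm (x ** y - x' ** y') <= a * b + c * d.
Proof.
move=> xa yb xc yd; apply: le_trans (nrm_distM _ _ _ _) _.
by apply: lerD; apply: ler_pM; rewrite ?nrm_ge0.
Qed.

Lemma nrm_distD_le (R : realType) (V : normedModType R[i]) (x y z : V) a b :
  nrm (x - y) <= a -> nrm (y - z) <= b -> nrm (x - z) <= a + b.
Proof. by move=> xy yz; apply: le_trans (nrm_distD _ y _) (lerD _ _). Qed.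

(** The first row [u] of matrix units generates all others as adj (u l) ** u l'. It is approximated
    inside one level; [T i0] times its adjoint is nearly idempotent and yields a genuine idempotent
    [q], of rank K n / L by [rank_partial_isometries]. *)
Lemma embedding_dvd (R : realType) (A : cstarAlgType R) K phi k s t p
    (L : nat) (psi : 'M[R[i]]_L -> A) :
  @tower R A K phi k s t p -> (0 < L)%N -> unital_embedding psi ->
  exists n, (L %| K n)%N.
Proof.
move=> tw L0 psiE; pose i0 := Ordinal L0.
pose u l := psi (delta_mx i0 l).
have adj_delta l l' : adj (delta_mx l l' : 'M[R[i]]_L) = delta_mx l' l.
  apply/matrixP => a b; rewrite !mxE andbC.
  by case: (_ && _); rewrite ?rmorph1 ?rmorph0.
have uu l l' : u l ** adj (u l') = if l == l' then u i0 else 0.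
  rewrite -(emb_adj psiE) adj_delta -(emb_mul psiE).
  rewrite -[_ ** _]/(_ *m _) mul_delta_mx_cond.
  by case: eqP => _; rewrite ?mulr1n // mulr0n (emb0 psiE).
have u1 l : nrm (u l) <= 1.
  rewrite -(ler_pXn2r (n := 2)) ?nnegrE ?nrm_ge0 // -nrm_cstar_r uu eqxx expr1n.
  by rewrite (nrm_delta psiE).
have usum : \sum_l (adj (u l) ** u i0) ** u l = sone.
  rewrite -(emb_one psiE) -[sone]/(1%:M : 'M[R[i]]_L).
  have -> : 1%:M = \sum_l delta_mx l l :> 'M[R[i]]_L.
    apply/matrixP => a b; rewrite !mxE summxE (bigD1 a) //= big1 => [|l /negPf
      la].
      by rewrite !mxE eqxx addr0 eq_sym.
    by rewrite !mxE eq_sym la.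
  rewrite (emb_sum psiE); apply: eq_bigr => l _.
  rewrite -(emb_adj psiE) adj_delta -!(emb_mul psiE).
  by rewrite -[_ ** _]/(_ *m _ *m _) !mul_delta_mx.
(* 2^L dominates both L and the constant of [hs_sum]. The errors accumulate to 27 e for [q], 30 e
   for the orthogonality relations and 60 e for each summand of the identity; the strictest demand,
   60 e 2^L < 1, holds with room to spare. *)
pose X : R := 2 ^+ L; pose e : R := (84 * X)^-1.
have X1 : 1 <= X by rewrite exprn_ege1 // ler1n.
have LX : L%:R <= X by rewrite /X -natrX ler_nat ltnW // ltn_expl.
have e0 : 0 < e by rewrite invr_gt0 mulr_gt0 // (lt_le_trans _ X1).
have eX : e * X = 84^-1 by rewrite /e invfM -mulrA mulVf ?mulr1 // gt_eqF //
  (lt_le_trans _ X1).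
have e_le : 84 * e <= 1.
  have : e * 1 <= e * X by rewrite ler_pM2l.
  by rewrite eX mulr1; move: (e) => x; clear; lra.
have /choice[N NP] := fun l => tower_approx tw (u l) e0.
pose n := \max_l N l.
have /choice[T Te] : forall l, exists a, nrm (phi n a - u l) < e.
  by move=> l; apply: NP; exact: leq_bigmax.
have phiE := tower_emb tw n.
pose T' l := phi n (T l).
have T2 l : nrm (T' l) <= 2.
  have := nrm_le_dist (T' l) (u l); have := u1 l; have := Te l;
    rewrite -/(T' l).
  by move: e_le; move: (e) (nrm _) (nrm _) (nrm _) => w x y z; clear; lra.
have TT l l' : nrm (T' l ** adj (T' l') - (if l == l' then u i0 else 0)) <= 3 *
  e.
  rewrite -uu; have -> : 3 * e = e * 2 + 1 * e by ring.
  by apply: nrm_distM_le; rewrite -?adjB ?nrm_adj // ltW // Te.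
pose h := T i0 *m mxct (T i0).
have hE : phi n h = T' i0 ** adj (T' i0).
  by rewrite -(emb_adj phiE) -(emb_mul phiE).
have hu : nrm (phi n h - u i0) <= 3 * e by have := TT i0 i0; rewrite eqxx hE.
have h2 : nrm (phi n h) <= 2.
  have := nrm_le_dist (phi n h) (u i0); have := u1 i0; have := hu.
  by move: e_le; move: (e) (nrm _) (nrm _) (nrm _) => w x y z; clear; lra.
have hh : nrm (phi n (h *m h - h)) <= 12 * e.
  have u_idem : u i0 ** u i0 = u i0.
    rewrite /u -(emb_mul psiE) -[_ ** _]/(_ *m _) mul_delta_mx //.
  rewrite (embB phiE) (emb_mul phiE h h).
  have -> : 12 * e = (3 * e * 2 + 1 * (3 * e)) + 3 * e by ring.
  apply: (nrm_distD_le (y := u i0)); last by rewrite nrmB.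
  by rewrite -u_idem; apply: nrm_distM_le.
have [q [qq qh]] : exists q, q *m q = q /\ nrm (phi n (q - h)) <= 2 * (12 * e).
  apply: spectral_projection => //; first by rewrite mulr_ge0 // ltW.
  by rewrite /h mxctM mxctK.
have qu : nrm (phi n q - u i0) <= 27 * e.
  have -> : 27 * e = 2 * (12 * e) + 3 * e by ring.
  by apply: (nrm_distD_le (y := phi n h)) => //; rewrite -(embB phiE).
exists n; suff <- : (L * \rank q)%N = K n by rewrite dvdn_mulr.
apply: (@rank_partial_isometries R A _ _ (phi n) phiE q T (30 * e)
  (L%:R * (60 * e))) => //.
- move=> l l'; rewrite (embB phiE) -[mxct (T l')]/(adj (T l')).
  rewrite (emb_mul phiE (T l)) (emb_adj phiE).
  rewrite -!/(T' _); case: eqP (TT l l') => [->|_ Tll].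
    move=> Tll; have -> : 30 * e = 3 * e + 27 * e by ring.
    by apply: (nrm_distD_le (y := u i0)) => //; rewrite nrmB.
  rewrite (emb0 phiE); apply: le_trans Tll _.
  by rewrite ler_pM2r // ler_nat.
- by rewrite mulr_ge0 // ltW.
- rewrite -/X; have : L%:R * X * (30 * e) ^+ 2 <= (30 * (e * X)) ^+ 2.
    rewrite -subr_ge0; have -> : (30 * (e * X)) ^+ 2 - L%:R * X * (30 * e) ^+ 2
      =
      (30 * e) ^+ 2 * (X * (X - L%:R)) by ring.
    have X0 : 0 <= X := le_trans ler01 X1.
    by apply: mulr_ge0 (sqr_ge0 _) (mulr_ge0 X0 _); rewrite subr_ge0.
  by rewrite eX; move: (L%:R * _ * _) => x; clear; lra.
- rewrite (embB phiE) -[1%:M]/(sone) (emb_one phiE) nrmB -usum (emb_sum phiE)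
  -sumrB.
  apply: le_trans (nrm_sum _ _ _) _.
  rewrite mulr_natl -[X in _ *+ X]card_ord -sumr_const; apply: ler_sum => l _.
  rewrite (emb_mul phiE (_ *m _)) (emb_mul phiE _ q) -[mxct (T l)]/(adj (T l))
    (emb_adj phiE).
  rewrite -!/(T' _).
  have auu : nrm (adj (u l) ** u i0) <= 1.
    apply: le_trans (nrmM _ _) _; rewrite nrm_adj -[1]mulr1.
    by apply: ler_pM; rewrite ?nrm_ge0.
  have q2 : nrm (phi n q) <= 2.
    have := nrm_le_dist (phi n q) (u i0); have := u1 i0; have := qu.
    by move: e_le; move: (e) (nrm _) (nrm _) (nrm _) => w x y z; clear; lra.
  have -> : 60 * e = (e * 2 + 1 * (27 * e)) * 2 + 1 * (2 * e) by ring.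
  apply: nrm_distM_le => //; last first.
    apply: ltW (lt_le_trans (Te l) _).
    by apply: ler_peMl; [exact: ltW|rewrite ler1n].
  by apply: nrm_distM_le; rewrite -?adjB ?nrm_adj // ltW // Te.
- have : L%:R * (60 * e) <= X * (60 * e) by rewrite ler_pM2r // mulr_gt0.
  by rewrite [X * _]mulrCA [X * e]mulrC eX; move: (L%:R * _) => x; clear; lra.
Qed.

(** * Averaging over unitaries *)

Section UnitaryDesign.
Variable R : realType.
Local Notation C := R[i].

(** For a != b, flipping the sign at [a] permutes the sign vectors and negates every term. *)
Lemma sum_signs n (a b : 'I_n) :
  \sum_(w : {ffun 'I_n -> bool}) (-1) ^+ w a * (-1) ^+ w b =
  (2 ^ n)%:R *+ (a == b) :> C.
Proof.
have [<-|ab] := eqVneq a b.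
  rewrite mulr1n (eq_bigr (fun=> 1)) => [|w _];
    last by rewrite -expr2 sqrr_sign.
  by rewrite sumr_const card_ffun card_bool card_ord.
rewrite mulr0n; set S := \sum_w _.
have : S = - S.
  pose h (w : {ffun 'I_n -> bool}) := [ffun c => w c (+) (c == a)].
  have hK : involutive h.
    by move=> w; apply/ffunP => c; rewrite !ffunE -addbA addbb addbF.
  rewrite {1}/S (reindex_inj (inv_inj hK)) /= -sumrN; apply: eq_bigr => w _.
  rewrite !ffunE eqxx eq_sym (negPf ab) addbF addbT -mulNr.
  by congr (_ * _); case: (w a); rewrite /= ?expr1 ?expr0 ?opprK.
move/eqP; rewrite -subr_eq0 opprK -mulr2n mulrn_eq0 /=.
by move/eqP.
Qed.

(* The orthogonality relations say that averaging over the [u w] sends a matrix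
   to its normalised trace; signed cyclic shifts satisfy them. *)
Lemma unitary_design n : (0 < n)%N ->
  exists (I : finType) (u : I -> 'M[C]_n) (c : nat),
  [/\ (0 < c)%N, #|I| = (c * n)%N, forall w, mxct (u w) *m u w = 1%:M &
      forall i j p q, \sum_w u w i p * Num.conj (u w j q) =
        c%:R *+ ((i == j) && (p == q))].
Proof.
case: n => // n _.
pose u (wr : {ffun 'I_n.+1 -> bool} * 'I_n.+1) : 'M[C]_n.+1 :=
  \matrix_(a, b) ((-1) ^+ wr.1 a *+ (b == a + wr.2)).
have signC (b : bool) : Num.conj ((-1) ^+ b : C) = (-1) ^+ b.
  by rewrite rmorphXn rmorphN1.
have uu wr a p b q : u wr a p * Num.conj (u wr b q) =
    ((-1) ^+ wr.1 a * (-1) ^+ wr.1 b) *+ ((p == a + wr.2) && (q == b + wr.2)).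
  by rewrite !mxE rmorphMn /= signC mulrnAl mulrnAr -mulrnA mulnb andbC.
exists ({ffun 'I_n.+1 -> bool} * 'I_n.+1)%type, u, (2 ^ n.+1)%N; split.
- by rewrite expn_gt0.
- by rewrite card_prod card_ffun card_bool card_ord.
- move=> wr; apply/matrixP => p q; rewrite !mxE.
  rewrite (bigD1 (p - wr.2)) //= big1 => [|a ap].
    rewrite addr0 [mxct _ _ _]mxE [map_mx _ _ _ _]mxE mulrC uu -expr2 sqrr_sign
      subrK eqxx andbT.
    by rewrite eq_sym.
  rewrite [mxct _ _ _]mxE [map_mx _ _ _ _]mxE mulrC uu.
  have /negPf -> : p != a + wr.2 by apply: contraNneq ap => ->; rewrite addrK.
  by rewrite andbF.
- move=> a b p q; under eq_bigr do rewrite uu.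
  rewrite -(pair_bigA _ (fun (w : {ffun 'I_n.+1 -> bool}) (r : 'I_n.+1) =>
    ((-1) ^+ w a * (-1) ^+ w b) *+ ((p == a + r) && (q == b + r)))) /=.
  rewrite exchange_big /=.
  under eq_bigr do rewrite sumrMnl sum_signs.
  have [<-|ab] := eqVneq a b; last by rewrite big1 // => r _;
    rewrite mulr0n mul0rn.
  rewrite (bigD1 (p - a)) //= big1 ?addr0 => [|r rp].
    by rewrite mulr1n addrC subrK eqxx eq_sym.
  have /negPf -> : p != a + r by apply: contraNneq rp => ->;
    rewrite addrC addKr.
  by rewrite mulr0n.
Qed.

Lemma infl_row_sum m d n s t p (u : 'M[C]_m) (F : nat -> C) x :
  index_split m d n s t p -> (x < n)%N ->
  \sum_(x' < n) ent (infl s t u : 'M[C]_n) x x' * F x' =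
  \sum_(a < m) ent u (s x) a * F (p a (t x)).
Proof.
move=> sp xn; rewrite (split_sum (fun x' => ent (infl s t u : 'M[C]_n) x x' * F
  x') sp).
apply: eq_bigr => a _.
have tx := split_snd sp xn; have pn := split_pair sp (ltn_ord a) tx.
rewrite (bigD1 (Ordinal tx)) //= big1 ?addr0 => [|e ne].
  by rewrite ent_infl // (split_fstK sp) // (split_sndK sp) // eqxx mulr1n.
have pen := split_pair sp (ltn_ord a) (ltn_ord e).
rewrite ent_infl // (split_sndK sp) //.
have /negPf -> : t x != e by apply: contraNneq ne => E; apply/eqP/val_inj.
by rewrite mulr0n mul0r.
Qed.

Lemma ent_sum m n (I : finType) (F : I -> 'M[C]_(m, n)) x y :
  (x < m)%N -> (y < n)%N ->
  ent (\sum_w F w) x y = \sum_w ent (F w) x y.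
Proof.
move=> xm yn; rewrite ent_ord summxE; apply: eq_bigr => w _.
by rewrite (ent_ord _ xm yn).
Qed.

(** Up to normalisation this is the conditional expectation onto the commutant of the inflated
    matrix algebra: the partial trace over [m], tensored with the identity. *)
Lemma ent_average m d n s t p (I : finType) (u : I -> 'M[C]_m) (c : nat)
    (z : 'M[C]_n) x y :
  index_split m d n s t p ->
  (forall i j p q, \sum_w u w i p * Num.conj (u w j q) =
     c%:R *+ ((i == j) && (p == q))) ->
  (x < n)%N -> (y < n)%N ->
  ent (\sum_w infl s t (u w) *m z *m mxct (infl s t (u w))) x y =
  c%:R * (\sum_(a < m) ent z (p a (t x)) (p a (t y))) *+ (s x == s y).
Proof.
move=> sp uu xn yn; rewrite ent_sum //.
pose U w : 'M[C]_n := infl s t (u w).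
have E w : ent (U w *m z *m mxct (U w)) x y =
    \sum_(b < m) \sum_(a < m)
      (ent (u w) (s x) a * Num.conj (ent (u w) (s y) b)) *
      ent z (p a (t x)) (p b (t y)).
  rewrite ent_mul //.
  have -> : \sum_(y' < n) ent (U w *m z) x y' *
        ent (mxct (U w)) y' y =
      Num.conj (\sum_(y' < n) ent (U w) y y' *
        Num.conj (ent (U w *m z) x y')).
    rewrite rmorph_sum; apply: eq_bigr => y' _.
    by rewrite ent_ct // rmorphM /= conjCK mulrC.
  rewrite (infl_row_sum _ (fun y' => Num.conj (ent (U w *m z) x y')) sp yn).
  rewrite rmorph_sum; apply: eq_bigr => b _.
  have bn := split_pair sp (ltn_ord b) (split_snd sp yn).
  rewrite rmorphM /= conjCK ent_mul //.
  rewrite (infl_row_sum _ (fun x' => ent z x' (p b (t y))) sp xn) mulr_sumr.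
  by apply: eq_bigr => a _; rewrite mulrCA mulrA.
under eq_bigr do rewrite E.
have sx := split_fst sp xn; have sy := split_fst sp yn.
rewrite exchange_big /= mulr_sumr -sumrMnl; apply: eq_bigr => b _.
have key (a : 'I_m) : \sum_w ent (u w) (s x) a * Num.conj (ent (u w) (s y) b) *
    ent z (p a (t x)) (p b (t y)) =
    c%:R *+ ((s x == s y) && (a == b)) * ent z (p a (t x)) (p b (t y)).
  rewrite -mulr_suml; congr (_ * _).
  have -> : (s x == s y) = (Ordinal sx == Ordinal sy) by [].
  rewrite -uu.
  by apply: eq_bigr => w _; rewrite -!entE.
rewrite exchange_big /=; under eq_bigr do rewrite key.
rewrite (bigD1 b) //= big1 => [|a /negPf ab].
  by rewrite addr0 eqxx andbT mulrnAl.
by rewrite ab andbF mulr0n mul0r.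
Qed.

End UnitaryDesign.

Section PeriodicSums.
Variables (R : realFieldType) (d : nat) (G : nat -> R).
Hypothesis Gd : forall c, G (c + d)%N = G c.

Lemma periodic_shift m : \sum_(c < d) G (m + c)%N = \sum_(c < d) G c.
Proof.
elim: m => [//|m <-]; case: (d) Gd => [|d' Gd']; first by rewrite !big_ord0.
rewrite big_ord_recr [RHS]big_ord_recl /= addn0 addrC.
rewrite addSnnS Gd'; congr (_ + _).
by apply: eq_bigr => c _; rewrite /bump /= addSnnS.
Qed.

(** The window contains l %/ d full periods wherever it starts; nonnegativity discards the
    remainder. *)
Lemma periodic_sum_ge m l : (forall c, 0 <= G c) ->
  (l %/ d)%:R * \sum_(c < d) G c <= \sum_(c < l) G (m + c)%N.
Proof.
move=> G0; have E q : \sum_(c < q * d) G (m + c)%N = q%:R * \sum_(c < d) G c.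
  elim: q => [|q IH]; first by rewrite mul0n big_ord0 mul0r.
  rewrite mulSn addnC big_split_ord /= IH -natr1 mulrDl mul1r; congr (_ + _).
  rewrite -(periodic_shift (m + q * d)).
  by apply: eq_bigr => c _; rewrite addnA.
rewrite -E.
suff : \sum_(c < l %/ d * d) G (m + c)%N <=
    \sum_(c < l %/ d * d + l %% d) G (m + c)%N by rewrite -divn_eq.
by rewrite big_split_ord /= lerDl sumr_ge0 // => c _; exact: G0.
Qed.

End PeriodicSums.

Section DiagonalAverage.
Variable R : realType.
Local Notation C := R[i].

Lemma ent_gram m n (y : 'M[C]_(m, n)) i : (i < n)%N ->
  ent (mxct y *m y) i i = (real_complex R (\sum_(b < m) nsq (ent y b i))).
Proof.
move=> im; rewrite ent_mul // rmorph_sum /=; apply: eq_bigr => b _.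
by rewrite ent_ct // nsqE mulrC.
Qed.

Variables (L d K : nat) (sg ta : nat -> nat) (pi : nat -> nat -> nat).
Hypothesis spJ : index_split L d K sg ta pi.
Variables (k K' : nat) (s t : nat -> nat) (p : nat -> nat -> nat).
Hypothesis spA : index_split K k K' s t p.
Variables (l L' : nat) (s' t' : nat -> nat) (p' : nat -> nat -> nat).
Hypothesis spB : index_split L l L' s' t' p'.

(** The multiplicity label of [x] for the L-matrices inside the K'-matrices, as in [split_comp]. The
    definitions below cut it in base l, as in [split_assoc], moving its low digit into the next
    index set of [B]. *)
Definition next_rho x := (t x * d + ta (s x))%N.
Definition next_fst x := p' (sg (s x)) (next_rho x %% l)%N.
Definition next_snd x := (next_rho x %/ l)%N.
Definition next_pair i f :=
  p (pi (s' i) ((f * l + t' i) %% d)%N) ((f * l + t' i) %/ d)%N.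

Lemma next_split e : (d * k = l * e)%N ->
  index_split L' e K' next_fst next_snd next_pair.
Proof.
move=> dk; have sp := split_comp spJ spA; rewrite dk in sp.
exact: split_assoc spB sp.
Qed.

(** Compatibility of consecutive levels: on both sides the label is [next_rho], written on the left
    as quotient and remainder modulo l. *)
Lemma next_infl e (b : 'M[C]_L) : (d * k = l * e)%N ->
  infl next_fst next_snd (infl s' t' b : 'M[C]_L') =
  infl s t (infl sg ta b : 'M[C]_K) :> 'M[C]_K'.
Proof.
move=> dk; have spN := next_split dk.
rewrite (infl_comp _ spB spN) (infl_comp _ spJ spA).
have E x : (x < K')%N -> s' (next_fst x) = sg (s x) /\ t' (next_fst x) =
  (next_rho x %% l)%N.
  move=> xK; have l0 : (0 < l)%N.
    have := split_snd (split_comp spJ spA) xK; rewrite dk.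
    by case: (l).
  have sx := split_fst spJ (split_fst spA xK).
  have rl : (next_rho x %% l < l)%N by rewrite ltn_mod.
  by rewrite /next_fst (split_fstK spB) // (split_sndK spB).
apply: eq_infl => [x xK|x y xK yK] /=; first by case: (E x xK).
by rewrite !(proj2 (E _ _)) // /next_snd -!divn_eq.
Qed.

(* For [d <= l] the numbers [f * l + c] and [g * l + c] lie in different blocks
   of length [d] unless [f = g], so that averaging over the unitaries of the
   next level kills the off-diagonal entries; the diagonal ones become averages
   of the diagonal of the given matrix over windows of length [l]. *)
Lemma average_diag (y : 'M[C]_K) e (I : finType) (u : I -> 'M[C]_L') c :
  (d * k = l * e)%N -> (0 < d <= l)%N -> #|I| = (c * L')%N ->
  (forall i j a b, \sum_w u w i a * Num.conj (u w j b) =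
     c%:R *+ ((i == j) && (a == b))) ->
  exists v : nat -> R, (forall x, #|I|%:R * hs y <= 2 * K%:R * v x) /\
   forall x x', (x < K')%N -> (x' < K')%N ->
    ent (\sum_w infl next_fst next_snd (u w) *m infl s t (mxct y *m y :
      'M[C]_K) *m
      mxct (infl next_fst next_snd (u w) : 'M[C]_K')) x x' =
    real_complex R (v x) *+ (x == x').
Proof.
move=> dk /andP[d0 dl] cardI uu; have spN := next_split dk.
pose g i := \sum_(b < K) nsq (ent y b i).
(* The diagonal of the partial trace of [mxct y *m y] over [L], continued with period d; one full
   period sums to [hs y]. *)
pose G r := \sum_(b < L) g (pi b (r %% d)%N).
have Gd r : G (r + d)%N = G r.
  by apply: eq_bigr => b _; rewrite modnDr.
have G0 r : 0 <= G r.
  by rewrite sumr_ge0 // => b _; rewrite sumr_ge0 // => *; exact: nsq_ge0.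
have GS : \sum_(r < d) G r = hs y.
  have -> : hs y = \sum_(b < K) g b by rewrite hs_ent exchange_big.
  rewrite (split_sum g spJ) exchange_big /=.
  by apply: eq_bigr => r _; apply: eq_bigr => b _; rewrite modn_small.
pose v x := c%:R * \sum_(r < l) G (next_snd x * l + r)%N.
exists v; split=> [x|x x' xK x'K].
  have := periodic_sum_ge Gd (next_snd x * l) l G0; rewrite GS /v => Gge.
  have -> : K%:R = (L * d)%:R :> R by rewrite -(split_size spJ).
  rewrite cardI (split_size spB).
  (* Source of the factor 2: l < (l %/ d + 1) d, and l %/ d >= 1 because d <= l. *)
  have llt : (l <= 2 * (l %/ d) * d)%N.
    have q1 : (1 <= l %/ d)%N by rewrite divn_gt0.
    apply: leq_trans (ltnW (ltn_ceil l d0)) _.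
    by rewrite leq_mul2r mul2n -addnn -addn1 leq_add2l q1 orbT.
  set S := \sum_(r < l) _ in Gge *.
  have -> : 2 * (L * d)%:R * (c%:R * S) = (2 * (L * d) * c)%:R * S :> R.
    by rewrite !natrM; ring.
  apply: le_trans (ler_wpM2l _ Gge) => //.
  rewrite mulrA -natrM ler_wpM2r ?hs_ge0 // ler_nat.
  have -> : (2 * (L * d) * c * (l %/ d) = c * L * (2 * (l %/ d) * d))%N by ring.
  by rewrite mulnA leq_mul2l llt orbT.
rewrite (ent_average _ spN uu xK x'K).
have pairE i f : (i < L')%N -> (f < e)%N -> (next_pair i f < K')%N.
  exact: (split_pair spN).
have lt i f : (i < L')%N -> (f < e)%N ->
    [/\ (pi (s' i) ((f * l + t' i) %% d) < K)%N & ((f * l + t' i) %/ d < k)%N].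
  move=> iL fe; split; first by rewrite (split_pair spJ) ?ltn_mod ?(split_fst
    spB).
  rewrite ltn_divLR // [(k * d)%N]mulnC dk; have := split_snd spB iL => il.
  apply: (@leq_trans (f.+1 * l)%N); first by rewrite mulSn addnC ltn_add2r.
  by rewrite mulnC leq_mul2l fe orbT.
have zE i f g' : (i < L')%N -> (f < e)%N -> (g' < e)%N ->
    ent (infl s t (mxct y *m y) : 'M[C]_K') (next_pair i f) (next_pair i g') =
    (real_complex R (g (pi (s' i) ((f * l + t' i) %% d)%N))) *+ (f == g').
  move=> iL fe ge; rewrite ent_infl ?pairE //.
  have [f1 f2] := lt _ _ iL fe; have [g1 g2] := lt _ _ iL ge.
  rewrite /next_pair !(split_fstK spA) // !(split_sndK spA) //.
  have [<-|fg] := eqVneq f g'; first by rewrite eqxx ent_gram.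
  suff /negPf -> : ((f * l + t' i) %/ d != (g' * l + t' i) %/ d)%N by [].
  have H a b : (a < b)%N -> ((a * l + t' i) %/ d < (b * l + t' i) %/ d)%N.
    move=> ab; apply: (@leq_trans ((a * l + t' i + d) %/ d)).
      by rewrite [in X in (_ < X)%N]addnC -{2}(mul1n d) divnMDl // add1n.
    apply: leq_div2r; rewrite addnAC leq_add2r.
    apply: (@leq_trans (a.+1 * l)); first by rewrite mulSn addnC leq_add2r.
    by rewrite leq_mul2r ab orbT.
  by case: (ltngtP f g') fg => // /H; [move=> /ltn_eqF -> | move=> /gtn_eqF ->].
under eq_bigr => i _ do rewrite zE ?(split_snd spN) //.
rewrite (split_sum (fun i => (real_complex R (g (pi (s' i)
   ((next_snd x * l + t' i) %% d)%N))) *+ (next_snd x == next_snd x')) spB).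
rewrite exchange_big /=.
have -> : \sum_(j < l) \sum_(i < L)
   real_complex R (g (pi (s' (p' i j)) ((next_snd x * l + t' (p' i j)) %%
     d)%N)) *+
   (next_snd x == next_snd x') =
   real_complex R (\sum_(r < l) G (next_snd x * l + r)%N) *+ (next_snd x ==
     next_snd x').
  rewrite rmorph_sum -sumrMnl /=; apply: eq_bigr => j _.
  rewrite rmorph_sum -sumrMnl /=; apply: eq_bigr => i _.
  by rewrite (split_fstK spB) // (split_sndK spB).
rewrite mulrnAr -mulrnA mulnb /v rmorphM rmorph_nat; congr (_ *+ nat_of_bool _).
apply/andP/eqP => [[/eqP t_eq /eqP s_eq]|-> //].
by rewrite -(split_pairK spN xK) -(split_pairK spN x'K) t_eq s_eq.
Qed.

End DiagonalAverage.

(** * Extension of an embedding to the completion *)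

Section Extension.
Variable R : realType.
Local Notation C := R[i].

Lemma cauchy_nrm (V : completeNormedModType C) (u : nat -> V) :
  (forall e : R, 0 < e -> exists N, forall n, (N <= n)%N ->
    nrm (u n - u N) < e) ->
  exists z, forall e : R, 0 < e ->
    exists N, forall n, (N <= n)%N -> nrm (u n - z) < e.
Proof.
move=> u_cauchy.
have realC (e : C) : 0 < e -> exists2 r : R, 0 < r & e = real_complex R r.
  case: e => a b; rewrite ltcE /= => /andP[/eqP b0 a0]; exists a => //.
  by rewrite b0.
have : cvg (u @ \oo).
  apply: cauchy_cvg; apply: cauchy_exP => e /realC[r r0 ->].
  have [N uN] := u_cauchy r r0; exists (u N); exists N => // n /= Nn.
  by rewrite -ball_normE /= nrmE ltcR nrmB uN.
move=> /cvg_ex[z uz]; exists z => e e0.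
have e0' : 0 < real_complex R e by rewrite ltcR.
move/cvgrPdist_lt/(_ _ e0') : uz => [N _ uN]; exists N => n Nn.
by have := uN n Nn; rewrite nrmE ltcR nrmB.
Qed.

Variables (A B : cstarAlgType R).
Variables (L : nat -> nat) (psi : forall n, 'M[C]_(L n) -> B).
Variables (l : nat -> nat) (s t : nat -> nat -> nat) (p : nat -> nat -> nat ->
  nat).
Arguments psi : clear implicits.
Hypothesis tw : tower psi l s t p.
Variable gam : forall n, 'M[C]_(L n) -> A.
Arguments gam : clear implicits.
Hypothesis gamE : forall n, unital_embedding (gam n).
Hypothesis gam_infl : forall n b, gam n.+1 (infl (s n) (t n) b) = gam n b.

Lemma gam_le i j (b : 'M[C]_(L i)) : (i <= j)%N ->
  exists b', psi j b' = psi i b /\ gam j b' = gam i b.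
Proof.
elim: j => [|j IH]; first by rewrite leqn0 => /eqP ij; subst i; exists b.
rewrite leq_eqVlt => /predU1P[ij|]; first by subst i; exists b.
move=> /IH [b' [<- <-]]; exists (infl (s j) (t j) b').
by rewrite (tower_infl tw) gam_infl.
Qed.

(** The closure of the graph of the level maps. Working with a relation turns each algebraic law of
    the extension into a closure property, with no sequences chosen. *)
Definition emb_graph (x : B) (z : A) := forall e : R, 0 < e ->
  exists n b, nrm (psi n b - x) < e /\ nrm (gam n b - z) < e.

Lemma emb_graph2 x z x' z' (e : R) : emb_graph x z -> emb_graph x' z' ->
  0 < e ->
  exists n b b', [/\ nrm (psi n b - x) < e, nrm (gam n b - z) < e,
    nrm (psi n b' - x') < e & nrm (gam n b' - z') < e].
Proof.
move=> xz xz' e0; have [i [b [bx bz]]] := xz e e0;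
  have [j [b' [bx' bz']]] := xz' e e0.
have [c [cx cz]] := gam_le b (leq_maxl i j).
have [c' [cx' cz']] := gam_le b' (leq_maxr i j).
by exists (maxn i j), c, c'; rewrite cx cz cx' cz'.
Qed.

Lemma gam_isometry n b : nrm (gam n b) = nrm (psi n b).
Proof. exact: emb_isometry (gamE n) (tower_emb tw n) b. Qed.

(** Inherited from the isometry of the levels. Taking x = x' makes the relation single-valued, and z
    = z' makes it injective. *)
Lemma emb_graph_dist x z x' z' : emb_graph x z -> emb_graph x' z' ->
  nrm (x - x') = nrm (z - z').
Proof.
move=> xz xz'.
suff : nrm (x - x') <= nrm (z - z') /\ nrm (z - z') <= nrm (x - x').
  by case=> le1 le2; apply/eqP; rewrite eq_le le1 le2.
have bnd (V : normedModType C) (a b a' b' : V) (e : R) : nrm (b - a) < e / 4 ->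
    nrm (b' - a') < e / 4 -> nrm (b - b') <= nrm (a - a') + e / 2 /\
    nrm (a - a') <= nrm (b - b') + e / 2.
  move=> ba ba'; split.
    apply: le_trans (nrm_distD _ a _) _; have := nrm_distD a a' b'.
    by rewrite [nrm (a' - b')]nrmB; move: ba ba'; lra.
  apply: le_trans (nrm_distD _ b _) _; have := nrm_distD b b' a'.
  by rewrite [nrm (a - b)]nrmB; move: ba ba'; lra.
split; apply/ler_addgt0Pr => e e0; have e4 : 0 < e / 4 by rewrite divr_gt0.
  have [n [b [b' [bx bz bx' bz']]]] := emb_graph2 xz xz' e4.
  have [_ x_le] := bnd _ _ _ _ _ _ bx bx';
    have [z_le _] := bnd _ _ _ _ _ _ bz bz'.
  rewrite -(embB (tower_emb tw n)) -gam_isometry (embB (gamE n)) in x_le.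
  by move: x_le z_le; lra.
have [n [b [b' [bx bz bx' bz']]]] := emb_graph2 xz xz' e4.
have [x_le _] := bnd _ _ _ _ _ _ bx bx';
  have [_ z_le] := bnd _ _ _ _ _ _ bz bz'.
rewrite -(embB (tower_emb tw n)) -gam_isometry (embB (gamE n)) in x_le.
by move: x_le z_le; lra.
Qed.

Lemma emb_graph_psi n b : emb_graph (psi n b) (gam n b).
Proof. by move=> e e0; exists n, b; rewrite !subrr !nrm0. Qed.

Lemma emb_graph_ex x : exists z, emb_graph x z.
Proof.
have pos m : 0 < m.+1%:R^-1 :> R by rewrite invr_gt0 ltr0n.
have small (e : R) : 0 < e -> exists N, forall n, (N <= n)%N -> n.+1%:R^-1 < e.
  move=> e0; exists (Num.bound e^-1) => n Nn.
  rewrite -[e]invrK ltf_pV2 ?posrE ?ltr0n ?invr_gt0 //.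
  have := archi_boundP (ltW (_ : 0 < e^-1)); rewrite invr_gt0 e0 => /(_ isT) lt.
  by apply: lt_le_trans lt _; rewrite ler_nat (leq_trans Nn).
have /choice[u uP] : forall m, exists u : {n & 'M[C]_(L n)},
    nrm (psi (tag u) (tagged u) - x) < m.+1%:R^-1.
  by move=> m; have [n [b bx]] := tower_dense tw x (pos m);
    exists (existT _ n b).
have graph m : emb_graph (psi (tag (u m)) (tagged (u m))) (gam (tag (u m))
  (tagged (u m))).
  exact: emb_graph_psi.
have [|z zP] := @cauchy_nrm _ (fun m => gam (tag (u m)) (tagged (u m))).
  move=> e e0; have [N Ne] := small _ (divr_gt0 e0 (ltr0n _ 2)).
  exists N => n Nn; rewrite -(emb_graph_dist (graph n) (graph N)).
  apply: le_lt_trans (nrm_distD _ x _) _; rewrite [nrm (x - _)]nrmB.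
  have := uP n; have := uP N; have := Ne n Nn; have := Ne N (leqnn _).
  by move: (nrm _) (nrm _) (_^-1) (n.+1%:R^-1) => a b c d; lra.
exists z => e e0; have [N Ne] := small e e0; have [M zM] := zP e e0.
exists (tag (u (maxn N M))), (tagged (u (maxn N M))); split.
  by apply: lt_trans (uP _) (Ne _ _); rewrite leq_maxl.
by apply: zM; rewrite leq_maxr.
Qed.

Lemma emb_graphM x z x' z' : emb_graph x z -> emb_graph x' z' ->
  emb_graph (x ** x') (z ** z').
Proof.
move=> xz xz' e e0.
(* One bound for both algebras, since the same matrices must approximate in [B] and in [A]. With e'
   <= 1 the product error is at most e' (|a| + |a'| + 1) < e' N <= e. *)
pose N := 2 + nrm x + nrm x' + nrm z + nrm z'.
have N2 : 2 <= N.
  rewrite /N; have := nrm_ge0 x; have := nrm_ge0 x'.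
  by have := nrm_ge0 z; have := nrm_ge0 z'; lra.
pose e' := Num.min 1 (e / N).
have e'0 : 0 < e' by rewrite lt_min ltr01 divr_gt0 // (lt_le_trans _ N2).
have e'1 : e' <= 1 by rewrite ge_min lexx.
have e'N : e' * N <= e.
  by rewrite -ler_pdivlMr ?(lt_le_trans _ N2) // ge_min lexx orbT.
have bnd (D : cstarAlgType R) (a b a' b' : D) : nrm (b - a) < e' ->
      nrm (b' - a') < e' ->
    nrm a + nrm a' + 1 < N -> nrm (b ** b' - a ** a') < e.
  move=> ba ba' aN; apply: le_lt_trans (nrm_distM _ _ _ _) _.
  have b'_le : nrm b' <= nrm a' + 1.
    by have := nrm_le_dist b' a'; move: ba' e'1; lra.
  apply: lt_le_trans e'N; apply: le_lt_trans (_ : _ <= e' * (nrm a + nrm a' +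
    1)) _.
    have := nrm_ge0 a; have := nrm_ge0 b'; have := nrm_ge0 (b - a).
    have := nrm_ge0 (b' - a'); have := nrm_ge0 a'.
    move: b'_le (ltW ba) (ltW ba') (ltW e'0); clear.
    move: (nrm _) (nrm _) (nrm _) (nrm _) (nrm _) (e') => a1 a2 a3 a4 a5 a6.
    nra.
  by rewrite ltr_pM2l.
have [n [b [b' [bx bz bx' bz']]]] := emb_graph2 xz xz' e'0.
exists n, (b ** b'); rewrite (emb_mul (tower_emb tw n)) (emb_mul (gamE n)).
have := nrm_ge0 x; have := nrm_ge0 x'; have := nrm_ge0 z; have := nrm_ge0 z'.
by split; apply: bnd => //; rewrite /N; lra.
Qed.

Lemma extend_embedding : exists2 iota : B -> A,
  unital_embedding iota & forall n b, iota (psi n b) = gam n b.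
Proof.
have /choice[iota iotaP] := emb_graph_ex.
have uniq x z : emb_graph x z -> iota x = z.
  move=> xz; apply/eqP; rewrite -subr_eq0 -nrm_eq0.
  by rewrite -(emb_graph_dist (iotaP x) xz) subrr nrm0.
exists iota; last by move=> n b; apply: uniq; exact: emb_graph_psi.
split=> [x y|a x|x y||x|x y xy].
- apply: uniq => e e0; have e2 : 0 < e / 2 by rewrite divr_gt0.
  have [n [b [b' [bx bz bx' bz']]]] := emb_graph2 (iotaP x) (iotaP y) e2.
  exists n, (b + b'); rewrite (emb_add (tower_emb tw n)) (emb_add (gamE n)).
  by split; rewrite opprD addrACA (le_lt_trans (nrmD _ _)) // [ltRHS]splitr
    ltrD.
- apply: uniq => e e0; pose a' := Num.sqrt (nsq a).
  have a'0 : 0 <= a' by rewrite sqrtr_ge0.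
  have e'0 : 0 < e / (1 + a') by rewrite divr_gt0 // ltr_pwDl.
  have [n [b [bx bz]]] := iotaP x _ e'0.
  exists n, (a *: b); rewrite (emb_scale (tower_emb tw n)) (emb_scale (gamE n)).
  rewrite -!scalerBr !nrmZ -/a'.
  have a'1 : 0 < 1 + a' by rewrite ltr_pwDl.
  rewrite !ltr_pdivlMr // in bx bz.
  have := nrm_ge0 (psi n b - x); have := nrm_ge0 (gam n b - iota x).
  by split; nra.
- by apply: uniq; exact: emb_graphM.
- apply: uniq => e e0; exists 0%N, sone.
  by rewrite (emb_one (tower_emb tw 0)) (emb_one (gamE 0)) !subrr !nrm0.
- apply: uniq => e e0; have [n [b [bx bz]]] := iotaP x _ e0.
  exists n, (adj b); rewrite (emb_adj (tower_emb tw n)) (emb_adj (gamE n)).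
  by rewrite -!adjB !nrm_adj.
- apply/eqP; rewrite -subr_eq0 -nrm_eq0 (emb_graph_dist (iotaP x) (iotaP y)).
  by rewrite xy subrr nrm0.
Qed.

End Extension.

(** * Irreducibility *)

Section IdealLemmas.
Variables (R : realType) (A : cstarAlgType R).
Local Notation C := R[i].

Lemma csub_sum (D : set A) (I : Type) (r : seq I) (F : I -> A) :
  D 0 -> (forall x y, D x -> D y -> D (x + y)) -> (forall i, D (F i)) ->
  D (\sum_(i <- r) F i).
Proof.
by move=> D0 Dadd DF; elim/big_ind: _ => // i _.
Qed.

Lemma closed_nrm (J : set A) x : closed J ->
  (forall e : R, 0 < e -> exists2 y, J y & nrm (y - x) < e) -> J x.
Proof.
move=> Jc Jx; apply: Jc => U /nbhs_ballP [e /= e0 eU].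
have [r r0 er] : exists2 r : R, 0 < r & e = real_complex R r.
  case: e e0 {eU} => a b; rewrite ltcE /= => /andP[/eqP b0 a0]; exists a => //.
  by rewrite b0.
have [y Jy yx] := Jx r r0; exists y; split=> //; apply: eU.
by rewrite er -ball_normE /= nrmE ltcR nrmB.
Qed.

(* With [z = 1 - w], the ideal contains [1 - z ^ n] for every [n]. *)
Lemma ideal_contains_one (D J : set A) w : cstar_subalgebra D -> D sone ->
  closed_ideal D J -> J w -> nrm (sone - w) < 1 -> J sone.
Proof.
move=> Dsub D1 Jid Jw wlt1; set z := sone - w in wlt1.
have Dz : D z.
  apply: (csubD Dsub) => //; rewrite -scaleN1r; apply: (csubZ Dsub).
  exact: ideal_sub Jid _ Jw.
have JN n : exists2 y, J y & nrm (y - sone) <= nrm z ^+ n.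
  elim: n => [|n [y Jy yn]].
    exists 0; first exact: ideal0 Jid.
    by rewrite sub0r nrmN expr0 nrm1_le.
  exists (w + z ** y); first by apply: (idealD Jid) => //; exact: (idealMl Jid).
  have zN : - z = w - sone by rewrite opprB.
  have -> : w + z ** y - sone = z ** (y - sone).
    by rewrite smulBr smul1r zN addrCA addrA.
  by apply: le_trans (nrmM _ _) _; rewrite exprS ler_wpM2l ?nrm_ge0.
apply: closed_nrm (ideal_closed Jid) _ => e e0.
have z_ge0 := nrm_ge0 z.
have /cvgrPdist_lt/(_ e e0)[n _ /(_ n (leqnn n))] : ((nrm z) ^+ n @[n --> \oo]
  --> 0).
  by apply: cvg_expr; rewrite ger0_norm.
rewrite sub0r normrN ger0_norm ?exprn_ge0 // => ze.
by have [y Jy yn] := JN n; exists y => //; apply: le_lt_trans ze.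
Qed.

Lemma nrm_diag n (phi : 'M[C]_n -> A) (z : 'M[C]_n) (v : nat -> R) (q : R) :
  unital_embedding phi -> 0 <= q ->
  (forall x y, (x < n)%N -> (y < n)%N ->
    ent z x y = real_complex R (v x) *+ (x == y)) ->
  (forall x, (x < n)%N -> `|v x| <= q) -> nrm (phi z) <= q.
Proof.
move=> phiE q0 zv vq.
have -> : z = diag_mx (\row_j real_complex R (v j)).
  by apply/matrixP => a b; rewrite -entE zv ?ltn_ord // !mxE; congr (_ *+ _).
apply: nrm_le_opbound => // w;
  rewrite /hs !big_ord1 mulr_sumr ler_sum // => j _.
rewrite mulmx_diag_row nsqM mulrC mxE nsq_real ler_wpM2r ?nsq_ge0 //.
by rewrite -real_normK ?num_real // ler_pXn2r ?nnegrE // vq.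
Qed.

Lemma nsq_ent_le n (phi : 'M[C]_n -> A) (z : 'M[C]_n) i j :
  unital_embedding phi -> nsq (z i j) <= nrm (phi z) ^+ 2.
Proof.
move=> phiE; have := hs_mulr phiE (row i 1%:M) z; rewrite -row_mul mul1mx.
rewrite hs_row1 mulr1; apply: le_trans.
by have := nsq_le_hs (row i z) 0 j; rewrite mxE.
Qed.

(* [hs z / K m] is the normalised trace of [z^* z].  The bound is uniform in [m]
   because it comes from a fixed row [v] of level [n] that almost attains the
   norm of [h], and normalised traces do not change under inflation. *)
Lemma trace_lower_bound K phi k s t p (h : A) :
  @tower R A K phi k s t p -> h != 0 ->
  exists kappa e N, [/\ 0 < kappa, 0 < e & forall m, (N <= m)%N ->
    forall z : 'M[C]_(K m), nrm (phi m z - h) < e -> kappa * (K m)%:R <= hs z].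
Proof.
move=> tw h0; set H := nrm h.
have H0 : 0 < H by rewrite lt_def nrm_eq0 h0 nrm_ge0.
have [n [y yh]] := tower_dense tw h (divr_gt0 H0 (ltr0n R 16)).
have phiE := tower_emb tw n.
have y_ge : H - H / 16 < nrm (phi n y).
  by have := nrm_le_dist h (phi n y); rewrite nrmB -/H; move: yh; lra.
have [v vy] : exists v : 'rV_(K n), (H / 2) ^+ 2 * hs v < hs (v *m y).
  apply/not_existsP => vy; have : nrm (phi n y) <= H / 2.
    apply: nrm_le_opbound => // [|v]; first by rewrite divr_ge0 // ltW.
    by rewrite leNgt; apply/negP; exact: vy.
  by move: y_ge H0; lra.
pose i0 := Ordinal (tower_gt0 tw n).
pose V : 'M[C]_(K n) := delta_mx i0 0 *m v.
have hsV (w : 'rV_(K n)) : hs (delta_mx i0 0 *m w) = hs w.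
  rewrite /hs (bigD1 i0) //= [X in _ + X]big1 ?addr0 => [|a /negPf ai].
    rewrite [RHS]big_ord1; apply: eq_bigr => j _;
      rewrite mxE big_ord1 !mxE !eqxx.
    by rewrite mul1r.
  by rewrite big1 // => j _; rewrite mxE big_ord1 !mxE ai mul0r nsq0.
have v0 : 0 < hs v.
  rewrite lt_def hs_ge0 andbT; apply/eqP => v0.
  have := hs_mulr phiE v y; rewrite v0 mulr0 leNgt => /negP[].
  by apply: le_lt_trans vy; rewrite v0 mulr0.
exists (H ^+ 2 / (16 * (K n)%:R)), (H / 16), n; split.
- by rewrite divr_gt0 ?exprn_gt0 // mulr_gt0 // ltr0n (tower_gt0 tw).
- by rewrite divr_gt0.
move=> m nm z zh; have [d [s' [t' [p' [d0 sp E]]]]] := tower_le tw nm.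
have iE := infl_emb R sp d0; have phimE := tower_emb tw m.
pose V' : 'M[C]_(K m) := infl s' t' V; pose y' : 'M[C]_(K m) := infl s' t' y.
have hV : hs V' = d%:R * hs v by rewrite /V' (hs_infl sp) hsV.
have hVy : hs (V' *m y') = d%:R * hs (v *m y).
  rewrite -[V' *m y']/(V' ** y') -(emb_mul iE) (hs_infl sp) -[V ** y]/(V *m y).
  by rewrite /V -mulmxA hsV.
(* Here [V'] acts as an operator: inflation leaves its norm, the root of [hs v], unchanged but
   multiplies [hs V'] by d. This forces [hs z] to grow like d: H^2/4 <= 2 H^2/64 + 2 (hs z) / d,
   which leaves more than the H^2/16 recorded in kappa. *)
have z1 : hs (V' *m z) <= hs v * hs z.
  have := hs_mull phimE z V'; rewrite /V' E.
  by have := nrm_row phiE i0 v => ->.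
have z2 : hs (V' *m (y' - z)) <= (H / 8) ^+ 2 * hs V'.
  apply: le_trans (hs_mulr phimE _ _) _; rewrite ler_wpM2r ?hs_ge0 //.
  rewrite ler_pXn2r ?nnegrE ?nrm_ge0 ?divr_ge0 ?(ltW H0) // (embB phimE) E.
  apply: le_trans (nrm_distD _ h _) _; rewrite [nrm (h - _)]nrmB.
  by move: yh zh; lra.
have := hsD (V' *m (y' - z)) (V' *m z); rewrite -mulmxDr subrK hVy => le1.
have d0' : 0 < d%:R :> R by rewrite ltr0n.
have -> : (K m)%:R = (K n)%:R * d%:R :> R by rewrite -natrM -(split_size sp).
have Kn0 : (K n)%:R != 0 :> R by rewrite pnatr_eq0 -lt0n (tower_gt0 tw).
have -> : H ^+ 2 / (16 * (K n)%:R) * ((K n)%:R * d%:R) = H ^+ 2 / 16 * d%:R.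
  by field.
rewrite hV in z2; rewrite -(ler_pM2l v0).
have dv : d%:R * ((H / 2) ^+ 2 * hs v) <= d%:R * hs (v *m y) by rewrite
  ler_pM2l // ltW.
have : 0 <= d%:R * H ^+ 2 * hs v by rewrite !mulr_ge0 // ?ltW // exprn_ge0 //
  ltW.
move: le1 z1 z2 dv; clear.
move: (hs (V' *m z)) (hs (V' *m (y' - z))) (hs (v *m y)) (hs v) (hs z) (d%:R).
move=> a b c x q r le1 z1 z2 dv pos.
have -> : x * (H ^+ 2 / 16 * r) = r * H ^+ 2 * x / 16 by field.
have e1 : r * ((H / 2) ^+ 2 * x) = r * H ^+ 2 * x / 4 by field.
have e2 : (H / 8) ^+ 2 * (r * x) = r * H ^+ 2 * x / 64 by field.
by rewrite e1 in dv; rewrite e2 in z2; move: le1 z1 z2 dv pos; clear; lra.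
Qed.

End IdealLemmas.

(** * The embedding built from interleaved towers *)

Section Construction.
Variables (R : realType) (A B : cstarAlgType R).
Local Notation C := R[i].
Variables (K : nat -> nat) (phi : forall n, 'M[C]_(K n) -> A).
Arguments phi : clear implicits.
Variables (k : nat -> nat) (s t : nat -> nat -> nat) (p : nat -> nat -> nat ->
  nat).
Hypothesis twA : tower phi k s t p.
Variables (L : nat -> nat) (psi : forall n, 'M[C]_(L n) -> B).
Arguments psi : clear implicits.
Variables (l : nat -> nat) (s' t' : nat -> nat -> nat)
  (p' : nat -> nat -> nat -> nat).
Hypothesis twB : tower psi l s' t' p'.
Hypothesis L0 : L 0%N = 1%N.
Hypothesis LK : forall n, (L n %| K n)%N.
Hypothesis KL : forall n, (K n <= L n.+1)%N.

Let d n := (K n %/ L n)%N.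

Lemma mult_step n : (d n * k n = l n * d n.+1)%N.
Proof.
have Ln0 := tower_gt0 twB n; apply/eqP; rewrite -(eqn_pmul2l Ln0); apply/eqP.
have E m : (L m * d m = K m)%N by rewrite mulnC divnK.
rewrite !mulnA E -(split_size (tower_split twA n)).
by rewrite -(split_size (tower_split twB n)) E.
Qed.

Lemma mult_le n : (0 < d n <= l n)%N.
Proof.
have Ln0 := tower_gt0 twB n.
rewrite divn_gt0 // dvdn_leq ?(tower_gt0 twA) //=.
by rewrite leq_divLR // mulnC -(split_size (tower_split twB n)).
Qed.

(** With functions on [nat] the recursion is not dependent, and correctness is proved afterwards. At
    level 0 the algebra of [B] is one-dimensional, so all of [K 0] is multiplicity. *)
Fixpoint level_split n : (nat -> nat) * (nat -> nat) * (nat -> nat -> nat) :=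
  if n is m.+1 then
    let: (sg, ta, pi) := level_split m in
    (next_fst (d m) sg ta (s m) (t m) (l m) (p' m),
     next_snd (d m) ta (s m) (t m) (l m),
     next_pair (d m) pi (p m) (l m) (s' m) (t' m))
  else (fun=> 0%N, id, fun _ e => e).

Lemma level_splitP n :
  index_split (L n) (d n) (K n) (level_split n).1.1 (level_split n).1.2
    (level_split n).2.
Proof.
elim: n => [|n] /=.
  by rewrite /d L0 divn1; split=> //= [[|i]].
case: (level_split n) => [[sg ta] pi] /= sp.
exact: (next_split sp (tower_split twA n) (tower_split twB n) (mult_step n)).
Qed.

Definition level_emb n (b : 'M[C]_(L n)) : A :=
  phi n (infl (level_split n).1.1 (level_split n).1.2 b).
Arguments level_emb : clear implicits.

Lemma level_embE n : unital_embedding (level_emb n).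
Proof.
have /andP[d0 _] := mult_le n.
exact: emb_comp (infl_emb R (level_splitP n) d0) (tower_emb twA n).
Qed.

Lemma level_emb_infl n b :
  level_emb n.+1 (infl (s' n) (t' n) b) = level_emb n b.
Proof.
rewrite /level_emb -[RHS](tower_infl twA); apply: (congr1 (phi n.+1)).
have := level_splitP n; rewrite /=; case: (level_split n) => [[sg ta] pi] /= sp.
exact: (next_infl sp (tower_split twA n) (tower_split twB n) b (mult_step n)).
Qed.

(** The unitaries sit one level above [y] and are chosen before it. The bound on [v] says that each
    diagonal entry is at least half of hs y / K n. *)
Lemma level_average n : exists (I : finType) (u : I -> 'M[C]_(L n.+1)),
  [/\ (0 < #|I|)%N, forall w, nrm (level_emb n.+1 (u w)) <= 1 &
   forall y : 'M[C]_(K n), exists (Z : 'M[C]_(K n.+1)) (v : nat -> R),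
     [/\ phi n.+1 Z = (real_complex R #|I|%:R^-1) *: \sum_w
           level_emb n.+1 (u w) ** phi n (adj y ** y) ** adj (level_emb n.+1 (u
             w)),
         forall x, hs y <= 2 * (K n)%:R * v x &
         forall x x', (x < K n.+1)%N -> (x' < K n.+1)%N ->
           ent Z x x' = real_complex R (v x) *+ (x == x')]].
Proof.
have [I [u [c [c0 cardI uu1 uu]]]] := unitary_design R (tower_gt0 twB n.+1).
have I0 : (0 < #|I|)%N by rewrite cardI muln_gt0 c0 (tower_gt0 twB).
exists I, u; split=> // [w|y].
  apply: nrm_isometry; rewrite -(emb_adj (level_embE n.+1)).
  by rewrite -(emb_mul (level_embE n.+1)) -[adj (u w) ** u w]/(mxct (u w) *m u
    w) uu1
    (emb_one (level_embE n.+1)).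
have [v [v_ge vE]] : exists v : nat -> R,
    (forall x, #|I|%:R * hs y <= 2 * (K n)%:R * v x) /\
   forall x x', (x < K n.+1)%N -> (x' < K n.+1)%N ->
    ent (\sum_w infl (level_split n.+1).1.1 (level_split n.+1).1.2 (u w) *m
      infl (s n) (t n) (mxct y *m y : 'M[C]_(K n)) *m
      mxct (infl (level_split n.+1).1.1 (level_split n.+1).1.2 (u w) : 'M[C]_(K
        n.+1))) x x' =
    real_complex R (v x) *+ (x == x').
  have := level_splitP n; rewrite /=;
    case: (level_split n) => [[sg ta] pi] /= sp.
  apply: (average_diag sp (tower_split twA n) (tower_split twB n) y (mult_step
    n)
            (mult_le n) cardI uu).
set Psi := \sum_w _ in vE.
exists (real_complex R #|I|%:R^-1 *: Psi), (fun x => #|I|%:R^-1 * v x).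
have I0' : 0 < #|I|%:R :> R by rewrite ltr0n.
split.
- rewrite (emb_scale (tower_emb twA n.+1)) (emb_sum (tower_emb twA n.+1)).
  congr (_ *: _); apply: eq_bigr => w _.
  rewrite (emb_mul (tower_emb twA n.+1) (_ *m _)) (emb_mul (tower_emb twA
    n.+1)).
  by rewrite (tower_infl twA) -(emb_adj (tower_emb twA n.+1)).
- move=> x; have := v_ge x; rewrite mulrC -ler_pdivlMr // => /le_trans; apply.
  by rewrite mulrC mulrCA.
- move=> x x' xK x'K; rewrite entZ // vE // rmorphM /= mulrnAr.
  by congr (_ *+ _).
Qed.

Lemma tower_irreducible :
  exists iota : B -> A, cstar_irreducible_embedding iota.
Proof.
have arith (b c m q : R) : 0 < m * q -> c <= m * (q / 4) ->
    b <= 1 - q / 2 * m -> b + c < 1 by lra.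
have [iota iotaE iota_psi] := extend_embedding twB level_embE level_emb_infl.
exists iota; split=> // D Dsub rangeD J Jid.
have D1 : D sone by apply: rangeD; exists sone => //; exact: emb_one iotaE.
have Dlev n b : D (level_emb n b) by apply: rangeD; exists (psi n b).
have [[x [Jx x0]]|J0] := pselect (exists x, J x /\ x != 0); last first.
  left; apply/seteqP; split=> [x Jx|x ->]; last exact: ideal0 Jid.
  by apply: contrapT => x0; apply: J0; exists x; split=> //; exact/eqP.
right; suff J1 : J sone.
  apply/seteqP; split=> y Jy; first exact: ideal_sub Jid _ Jy.
  by rewrite -(smul1r y); exact: (idealMl Jid).
pose h := adj x ** x.
have Dx := ideal_sub Jid Jx.
have Jh : J h by apply: (idealMl Jid) => //; exact: (csub_adj Dsub).
have hh : adj h = h by rewrite /h adjM adjK.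
have Dh := ideal_sub Jid Jh.
have Jhh : J (adj h ** h) by rewrite hh; exact: (idealMl Jid).
have h0 : h != 0 by rewrite -nrm_eq0 nrm_cstar expf_eq0 /= nrm_eq0.
have [kappa [e [N [kappa0 e0 tr_ge]]]] := trace_lower_bound twA h0.
set H := nrm h; have H0 : 0 <= H := nrm_ge0 h.
(* Bounds the norm of [adj y ** y], so that dividing by M puts the diagonal of the average between
   kappa / (2 M) and 1. *)
pose M := (H + 1) ^+ 2.
have M1 : 1 <= M by rewrite /M; nra.
(* The three demands: the trace bound for [y], the estimate by M, and a distance of at most kappa /
   4 between [adj y ** y] and [adj h ** h]. *)
pose e1 := Num.min e (Num.min 1 (kappa / (4 * (2 * H + 1)))).
have H1 : 0 < 2 * H + 1 by rewrite ltr_wpDl // mulr_ge0.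
have e1_gt0 : 0 < e1 by rewrite !lt_min e0 ltr01 divr_gt0 // mulr_gt0.
have e1_e : e1 <= e by rewrite ge_min lexx.
have e1_1 : e1 <= 1 by rewrite !ge_min lexx orbT.
have e1_k : 4 * (e1 * (2 * H + 1)) <= kappa.
  rewrite mulrCA -ler_pdivlMr ?mulr_gt0 // !ge_min lexx !orbT //.
have [N' N'P] := tower_approx twA h e1_gt0.
pose n := maxn N N'; have [y yh] := N'P n (leq_maxr _ _).
have {tr_ge}tr_ge := tr_ge n (leq_maxl _ _) y (lt_le_trans yh e1_e).
have phiE := tower_emb twA n.
have y_le : nrm (phi n y) <= H + 1.
  rewrite addrC (le_trans (nrm_le_dist _ h)) // lerD2r.
  exact: le_trans (ltW yh) e1_1.
have [I [u [I0 u1 avg]]] := level_average n.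
have {avg}[Z [v [ZE v_ge vE]]] := avg y.
pose U w := level_emb n.+1 (u w).
pose Phi a : A := real_complex R #|I|%:R^-1 *: \sum_w U w ** a ** adj (U w).
have I0' : 0 < #|I|%:R :> R by rewrite ltr0n.
have Phi_le a : nrm (Phi a) <= nrm a.
  rewrite /Phi nrmZr ?invr_ge0 // -ler_pdivlMl ?invr_gt0 // invrK.
  apply: le_trans (nrm_sum _ _ _) _.
  rewrite mulr_natl -sumr_const ler_sum // => w _.
  apply: le_trans (nrmM _ _) _; rewrite nrm_adj.
  apply: le_trans (ler_wpM2r (nrm_ge0 _) (nrmM _ _)) _.
  have Uw := u1 w; rewrite -/(U w) in Uw.
  by rewrite mulrAC ler_piMl ?nrm_ge0 // mulr_ile1 ?nrm_ge0.
have PhiB a b : Phi (a - b) = Phi a - Phi b.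
  rewrite /Phi -scalerBr -sumrB; congr (_ *: _); apply: eq_bigr => w _.
  by rewrite smulBr smulBl.
have J_Phi a : J a -> J (Phi a).
  move=> Ja; apply: (idealZ Jid); apply: csub_sum => [||w].
  - exact: ideal0 Jid.
  - exact: idealD Jid.
  - apply: (Defs.idealMr Jid); last exact: (idealMl Jid (Dlev _ _)).
    exact: (csub_adj Dsub (Dlev _ _)).
set a := phi n (adj y ** y) in ZE.
have aE : a = adj (phi n y) ** phi n y by rewrite /a (emb_mul phiE) (emb_adj
  phiE).
have a_le : nrm a <= M.
  by rewrite aE nrm_cstar /M ler_pXn2r ?nnegrE ?nrm_ge0 // addr_ge0.
have a_h : nrm (a - adj h ** h) <= e1 * (2 * H + 1).
  have -> : e1 * (2 * H + 1) = e1 * (H + 1) + H * e1 by ring.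
  rewrite aE; apply: nrm_distM_le => //; last exact: ltW.
    by rewrite -adjB nrm_adj ltW.
  by rewrite nrm_adj.
have ZPhi : phi n.+1 Z = Phi a by [].
have Kn0 : 0 < (K n)%:R :> R by rewrite ltr0n (tower_gt0 twA).
have v_k z : kappa / 2 <= v z.
  have := le_trans tr_ge (v_ge z).
  by rewrite [2 * _ * _]mulrAC ler_pM2r // [2 * _]mulrC -ler_pdivrMr.
have v_M z : (z < K n.+1)%N -> v z <= M.
  move=> zK; have := nsq_ent_le Z (Ordinal zK) (Ordinal zK) (tower_emb twA
    n.+1).
  rewrite -entE vE // eqxx mulr1n nsq_real => v2.
  have {}v2 : `|v z| <= nrm (phi n.+1 Z).
    by rewrite -(ler_pXn2r (n := 2)) ?nnegrE ?nrm_ge0 // real_normK ?num_real.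
  apply: le_trans (ler_norm _) (le_trans v2 _).
  by rewrite ZPhi (le_trans (Phi_le _)).
have M0 : 0 < M := lt_le_trans ltr01 M1.
(* 1 - w splits into a diagonal matrix of norm at most 1 - kappa / (2 M) and an error of norm at
   most kappa / (4 M). The approximant [y] may lie outside [D]; only [w] has to be in [J]. *)
pose w := real_complex R M^-1 *: Phi (adj h ** h).
apply: (ideal_contains_one Dsub D1 Jid (w := w)).
  by apply: (idealZ Jid); exact: J_Phi.
have diag_le : nrm (phi n.+1 (1%:M - real_complex R M^-1 *: Z)) <= 1 - kappa /
  2 / M.
  apply: (nrm_diag (v := fun z => 1 - M^-1 * v z)) (tower_emb twA n.+1) _ _ _.
  - rewrite subr_ge0 ler_pdivrMr // mul1r.
    exact: le_trans (v_k 0%N) (v_M 0%N (tower_gt0 twA _)).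
  - move=> z z' zK z'K; rewrite entD // ent1 // -scaleN1r scalerA entZ // vE //.
    by rewrite rmorphB rmorph1 rmorphM /= mulrnBl mulN1r mulrnAr mulNr mulNrn.
  - move=> z zK; rewrite ger0_norm; last first.
      by rewrite subr_ge0 mulrC ler_pdivrMr // mul1r v_M.
    by rewrite lerD2l lerN2 mulrC ler_pM2l ?invr_gt0.
have -> : sone - w = phi n.+1 (1%:M - real_complex R M^-1 *: Z) +
    real_complex R M^-1 *: Phi (a - adj h ** h).
  rewrite (embB (tower_emb twA n.+1)) -[1%:M]/sone
    (emb_one (tower_emb twA n.+1)).
  by rewrite (emb_scale (tower_emb twA n.+1)) ZPhi PhiB scalerBr subrKA.
apply: le_lt_trans (nrmD _ _) _.
have : nrm (real_complex R M^-1 *: Phi (a - adj h ** h)) <= M^-1 * (kappa / 4).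
  rewrite nrmZr ?invr_ge0 ?(ltW M0) // ler_pM2l ?invr_gt0 //.
  by apply: le_trans (Phi_le _) (le_trans a_h _); rewrite ler_pdivlMr // mulrC.
have : 0 < M^-1 * kappa by rewrite mulr_gt0 ?invr_gt0.
by move=> Mk cM; exact: arith Mk cM diag_le.
Qed.

End Construction.

(** Gives an explicit level of [B] beyond any size in [A]: index K m already has size greater than K
    m. *)
Lemma tensor_size_gt (k : nat -> nat) n :
  (forall n, (2 <= k n)%N) -> (n < tensor_size k n)%N.
Proof.
move=> k2; elim: n => //= n IH; apply: (@leq_trans (n.+1 * 2)).
  by rewrite muln2 -addnn -[n.+2]addn1 leq_add2l.
by rewrite leq_mul.
Qed.

Unset Implicit Arguments.

Theorem theorem6p8 (R : realType) (A B : cstarAlgType R)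
  (hA : UHF A) (hB : UHF B)
  (hBA : exists f : B -> A, unital_embedding f) :
  exists iota : B -> A, cstar_irreducible_embedding iota.
Proof.
have [kA [phi [s [t [p [kA2 twA]]]]]] := uhf_tower hA.
have [kB [psi [s' [t' [p' [kB2 twB]]]]]] := uhf_tower hB.
have [f fE] := hBA; set K := tensor_size kA in phi twA *.
set L := tensor_size kB in psi twB *.
have K_dvd i j : (i <= j)%N -> (K i %| K j)%N.
  move=> ij; have [d [? [? [? [_ sp _]]]]] := tower_le twA ij.
  by rewrite (split_size sp) dvdn_mulr.
(* The given embedding enters here: composed with the levels of [B], it puts their matrix units into
   [A]. *)
have L_dvd n : exists m, (L n %| K m)%N.
  exact: embedding_dvd twA (tower_gt0 twB n) (emb_comp (tower_emb twB n) fE).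
(* One interleaving step on pairs (level of [B], level of [A]). Iterated from (0, 0), where [L] is
   1, it yields the divisibility and growth conditions of the construction. *)
have /choice[F FP] : forall q : nat * nat, exists q' : nat * nat,
    [/\ (q.1 < q'.1)%N, (q.2 < q'.2)%N, (K q.2 <= L q'.1)%N &
      (L q'.1 %| K q'.2)%N].
  move=> [n m] /=; pose n' := maxn n.+1 (K m); have [m' Lm'] := L_dvd n'.
  exists (n', maxn m.+1 m'); split=> /=.
  - exact: leq_maxl.
  - exact: leq_maxl.
  - exact: leq_trans (leq_maxr _ _) (ltnW (tensor_size_gt _ kB2)).
  - exact: dvdn_trans Lm' (K_dvd _ _ (leq_maxr _ _)).
pose q i := iter i F (0%N, 0%N).
have q1 i : ((q i).1 < (q i.+1).1)%N by case: (FP (q i)).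
have q2 i : ((q i).2 < (q i.+1).2)%N by case: (FP (q i)).
have [kA' [sA [tA [pA twA']]]] := tower_subseq twA (h := fun i => (q i).2) q2.
have [kB' [sB [tB [pB twB']]]] := tower_subseq twB (h := fun i => (q i).1) q1.
apply: (tower_irreducible twA' twB') => // [[|i]|i] /=.
- exact: dvd1n.
- by have [] := FP (q i).
- by have [] := FP (q i).
Qed.
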